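(* Let $G$ be a topological group satisfying a law and let $T$ be a bounded rooted tree. Then, for every continuous group homomorphism $\rho:G\to \mathrm{Aut}\,T$, the image $H:=\rho(G)$ has strong zero Hausdorff dimension in $\mathrm{Aut}\,T$, i.e. $$\lim_{k\to\infty}\frac{\log|H:\mathrm{St}_H(k)|}{\log|\mathrm{Aut}\,T:\mathrm{St}(k)|}=0 .$$
   Context: A group $G$ satisfies a law if there are $r\ge 1$ and a non-trivial element $w$ of the free group of rank $r$ such that $w(g_1,\dots,g_r)=1$ for all $g_1,\dots,g_r\in G$. A bounded rooted tree $T$ is an infinite rooted tree for which there exist an integer $M\ge 2$ and integers $2\le m_k\le M$ ($k\ge 0$) such that every vertex at level $k$ (distance $k$ from the root) has exactly $m_k$ immediate descendants. $\mathrm{Aut}\,T$ is the group of graph automorphisms of $T$ fixing the root. For $k\ge 0$, $\mathrm{St}(k)$ is the pointwise stabilizer in $\mathrm{Aut}\,T$ of the vertices at level $k$, and $\mathrm{St}_H(k)=H\cap \mathrm{St}(k)$ for $H\le \mathrm{Aut}\,T$. $\mathrm{Aut}\,T$ is a profinite group with topology given by the open normal subgroups $\mathrm{St}(k)$, $k\ge 0$. A subgroup $H$ is said to have strong zero Hausdorff dimension in $\mathrm{Aut}\,T$ if $\frac{\log|H:\mathrm{St}_H(k)|}{\log|\mathrm{Aut}\,T:\mathrm{St}(k)|}\to 0$ as $k\to\infty$ (the indices are the same for $H$ and for its closure in $\mathrm{Aut}\,T$). *)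

(* Defs.v *)
(* Setting: MathComp and MathComp-Analysis *)
From HB Require Import structures.
From mathcomp Require Import all_boot all_order all_algebra.
From mathcomp Require Import finmap.
From mathcomp Require Import all_classical all_reals all_analysis.
Import numFieldNormedType.Exports.

Set Implicit Arguments.
Unset Strict Implicit.
Unset Printing Implicit Defensive.

Local Open Scope classical_set_scope.

(* [(i, false)] stands for the generator x_i and [(i, true)] for its inverse. *)
Definition letter (r : nat) : Type := ('I_r * bool)%type.

Section FreeGroup.
Variable r : nat.
Implicit Types (a b : letter r) (u v w : seq (letter r)).

Definition linv a : letter r := (a.1, ~~ a.2).

Definition reduced w : bool := sorted (fun a b => a != linv b) w.

Definition cons_red a w : seq (letter r) :=
  if w is b :: w' then if a == linv b then w' else a :: w else [:: a].

(* The reduced form of [u ++ v], for [v] reduced. *)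
Definition cat_red u v : seq (letter r) := foldr cons_red v u.

Lemma linvK : involutive linv.
Proof. by case=> i b; rewrite /linv /= negbK. Qed.

Lemma linv_eq a b : (linv a == b) = (a == linv b).
Proof. by apply/eqP/eqP => [<-|->]; rewrite linvK. Qed.

Lemma cons_red_reduced a w : reduced w -> reduced (cons_red a w).
Proof.
case: w => //= b w; case: eqP => [_ | /eqP nab]; first exact: path_sorted.
by rewrite /reduced /= nab.
Qed.

Lemma cat_red_reduced u v : reduced v -> reduced (cat_red u v).
Proof. by move=> rv; elim: u => //= a u; apply: cons_red_reduced. Qed.

Lemma cons_redK a w : reduced w -> cons_red a (cons_red (linv a) w) = w.
Proof.
case: w => [|b w] /=; first by rewrite linvK eqxx.
rewrite (inj_eq (inv_inj linvK)); case: eqP => [-> | _ _] /=.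
  case: w => //= c w; rewrite /reduced /= => /andP[].
  by case: eqP.
by rewrite linvK eqxx.
Qed.

Lemma cat_red_cons a u w :
  reduced w -> cat_red (cons_red a u) w = cons_red a (cat_red u w).
Proof.
move=> rw; case: u => //= b u; case: eqP => [->|//].
by rewrite -{2}(linvK b) cons_redK //; apply: cat_red_reduced.
Qed.

Lemma cat_redA u v w :
  reduced w -> cat_red u (cat_red v w) = cat_red (cat_red u v) w.
Proof. by move=> rw; elim: u => //= a u ->; rewrite cat_red_cons. Qed.

Lemma cat_red0 u : reduced u -> cat_red u [::] = u.
Proof.
elim: u => //= a u IH au; rewrite IH; last exact: path_sorted au.
by case: u au {IH} => //= b u; rewrite /reduced /= => /andP[/negPf -> _].
Qed.

Definition word_inv u : seq (letter r) := rev (map linv u).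

Lemma word_inv_reduced u : reduced u -> reduced (word_inv u).
Proof.
rewrite /reduced /word_inv rev_sorted sorted_map; apply: sub_sorted => a b /=.
by rewrite linvK eq_sym linv_eq eq_sym linv_eq eq_sym.
Qed.

Lemma cat_redV u : cat_red (word_inv u) u = [::].
Proof.
rewrite /word_inv; elim: u => //= a u IH.
by rewrite rev_cons /cat_red foldr_rcons /= eqxx.
Qed.

Lemma word_invK : involutive word_inv.
Proof. by move=> u; rewrite /word_inv map_rev revK (mapK linvK). Qed.

(* The free group on x_0, ..., x_(r-1), realized on the reduced words. *)
Record free_group : Type :=
  FreeGroup { word :> seq (letter r); _ : reduced word }.

HB.instance Definition _ := [isSub for word].
HB.instance Definition _ := [Choice of free_group by <:].

Lemma word_reduced (w : free_group) : reduced w.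
Proof. by case: w. Qed.

Definition fg_one : free_group := @FreeGroup [::] isT.
Definition fg_mul (u v : free_group) : free_group :=
  FreeGroup (cat_red_reduced u (word_reduced v)).
Definition fg_inv (u : free_group) : free_group :=
  FreeGroup (word_inv_reduced (word_reduced u)).

Lemma fg_mulA : associative fg_mul.
Proof.
by move=> u v w; apply: val_inj; rewrite /= cat_redA // word_reduced.
Qed.
Lemma fg_mul1g : left_id fg_one fg_mul.
Proof. by move=> u; apply: val_inj. Qed.
Lemma fg_mulg1 : right_id fg_one fg_mul.
Proof. by move=> u; apply: val_inj; rewrite /= cat_red0 // word_reduced. Qed.
Lemma fg_mulVg : left_inverse fg_one fg_inv fg_mul.
Proof. by move=> u; apply: val_inj; rewrite /= cat_redV. Qed.
Lemma fg_mulgV : right_inverse fg_one fg_inv fg_mul.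
Proof.
by move=> u; apply: val_inj; rewrite /= -{1}(word_invK u) cat_redV.
Qed.

HB.instance Definition _ := isGroup.Build free_group
  fg_mulA fg_mul1g fg_mulg1 fg_mulVg fg_mulgV.

End FreeGroup.

Section LawEvaluation.
Variables (r : nat) (G : groupType) (g : 'I_r -> G).
Local Open Scope group_scope.

Definition letter_eval (a : letter r) : G :=
  if a.2 then (g a.1)^-1 else g a.1.

(* w(g_0, ..., g_(r-1)) *)
Definition law_eval (w : free_group r) : G :=
  foldr (fun a x => letter_eval a * x) 1 w.

Lemma law_evalM : {morph law_eval : u v / u * v}.
Proof.
have evV a : letter_eval (linv a) = (letter_eval a)^-1.
  by case: a => i [] /=; rewrite /letter_eval //= invgK.
move=> u v; rewrite /law_eval /=; elim: (word u) => /= [|a s IH].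
  by rewrite mul1g.
rewrite -mulgA -IH; case: (cat_red s v) => //= b t; case: eqP => [->|//].
by rewrite evV mulKg.
Qed.

End LawEvaluation.

Definition satisfies_law (G : groupType) : Prop :=
  exists r : nat, (1 <= r)%N /\
  exists w : free_group r, w <> 1%g /\
  forall g : 'I_r -> G, law_eval g w = 1%g.

HB.mixin Record Group_isTopologicalGroup G & Group G & Topological G := {
  mulg_continuous : continuous (fun x : G * G => (x.1 * x.2)%g);
  invg_continuous : continuous (fun x : G => x^-1%g)
}.

#[short(type="topologicalGroupType")]
HB.structure Definition TopologicalGroup :=
  {G of Group G & Topological G & Group_isTopologicalGroup G}.

(* A connected simple graph without cycles, with a distinguished vertex. *)
Record rooted_tree : Type := RootedTree {
  vertex :> choiceType;
  adj : rel vertex;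
  root : vertex;
  adj_sym : symmetric adj;
  adj_irr : irreflexive adj;
  adj_connected : forall x y, exists2 p, path adj x p & last x p = y;
  adj_acyclic : forall c, (2 < size c)%N -> ~ ucycle adj c
}.

Section RootedTree.
Variable T : rooted_tree.

Definition joined_by (x y : T) (n : nat) : Prop :=
  exists p, [/\ path (@adj T) x p, last x p = y & size p = n].

Lemma joined_by_exists (x y : T) : exists n, `[< joined_by x y n >].
Proof.
have [p xp lp] := adj_connected x y.
by exists (size p); apply/asboolP; exists p.
Qed.

Definition dist (x y : T) : nat := ex_minn (joined_by_exists x y).

Definition level (v : T) : nat := dist (root T) v.

Definition children (v : T) : set T :=
  [set u | adj v u /\ level u = (level v).+1].

Definition bounded_tree : Prop :=
  infinite_set [set: T] /\
  exists (M : nat) (m : nat -> nat),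
    [/\ (2 <= M)%N,
        forall k, (2 <= m k <= M)%N
      & forall v, (children v #= `I_(m (level v)))%card].

Record Aut : Type := MkAut {
  aut_fun :> T -> T;
  aut_bij : bijective aut_fun;
  aut_adj : forall x y, adj (aut_fun x) (aut_fun y) = adj x y;
  aut_root : aut_fun (root T) = root T
}.

HB.instance Definition _ := gen_eqMixin Aut.
HB.instance Definition _ := gen_choiceMixin Aut.

Lemma autP (g h : Aut) : g =1 h -> g = h.
Proof.
case: g h => [f bf af rf] [f' bf' af' rf'] /= /funext ff'.
by subst f'; congr MkAut; apply: Prop_irrelevance.
Qed.

Definition aut_one : Aut :=
  @MkAut id (Bijective (frefl _) (frefl _)) (fun _ _ => erefl) erefl.

Definition aut_mul (g h : Aut) : Aut.
Proof.
refine (@MkAut (g \o h) (bij_comp (aut_bij g) (aut_bij h)) _ _).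
- by move=> x y; rewrite /= !aut_adj.
- by rewrite /= !aut_root.
Defined.

Lemma aut_inv_exists (g : Aut) : exists f : T -> T, cancel g f /\ cancel f g.
Proof. by case: (aut_bij g) => f gK fK; exists f. Qed.

Definition aut_invf (g : Aut) : T -> T := projT1 (cid (aut_inv_exists g)).

Lemma aut_funK (g : Aut) : cancel g (aut_invf g).
Proof. by case: (projT2 (cid (aut_inv_exists g))). Qed.

Lemma aut_invfK (g : Aut) : cancel (aut_invf g) g.
Proof. by case: (projT2 (cid (aut_inv_exists g))). Qed.

Definition aut_inv (g : Aut) : Aut.
Proof.
refine (@MkAut (aut_invf g) (Bijective (aut_invfK g) (aut_funK g)) _ _).
- by move=> x y; rewrite -(aut_adj g) !aut_invfK.
- by rewrite -{1}(aut_root g) aut_funK.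
Defined.

Lemma aut_mulA : associative aut_mul.
Proof. by move=> f g h; apply: autP. Qed.
Lemma aut_mul1g : left_id aut_one aut_mul.
Proof. by move=> f; apply: autP. Qed.
Lemma aut_mulg1 : right_id aut_one aut_mul.
Proof. by move=> f; apply: autP. Qed.
Lemma aut_mulVg : left_inverse aut_one aut_inv aut_mul.
Proof. by move=> f; apply: autP => x; apply: aut_funK. Qed.
Lemma aut_mulgV : right_inverse aut_one aut_inv aut_mul.
Proof. by move=> f; apply: autP => x; apply: aut_invfK. Qed.

HB.instance Definition _ := isGroup.Build Aut
  aut_mulA aut_mul1g aut_mulg1 aut_mulVg aut_mulgV.

Definition St (k : nat) : set Aut :=
  [set g | forall v, level v = k -> g v = v].

Lemma St1 k : St k 1%g.
Proof. by move=> v _. Qed.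

Lemma StM k (g h : Aut) : St k g -> St k h -> St k (g * h)%g.
Proof. by move=> gk hk v vk; rewrite /= hk // gk. Qed.

Lemma StV k (g : Aut) : St k g -> St k g^-1%g.
Proof.
move=> gk v vk; rewrite -{1}(gk v vk).
by have /(congr1 (fun f : Aut => f v)) := mulVg g.
Qed.

Lemma level_aut (g : Aut) (v : T) : level (g v) = level v.
Proof.
have le (h : Aut) (u : T) : (level (h u) <= level u)%N.
  rewrite /level /dist; case: ex_minnP => n _ nmin.
  case: ex_minnP => m /asboolP[p [rp lp <-]] _; rewrite -(size_map h).
  apply/nmin/asboolP; exists (map h p); split=> //.
    rewrite -(aut_root h) path_map; apply: sub_path rp => x y /=.
    by rewrite aut_adj.
  by rewrite -(aut_root h) last_map lp.
apply/eqP; rewrite eqn_leq le /=.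
have {1}<- : (g^-1 * g)%g v = v by rewrite mulVg.
exact: le.
Qed.

Lemma StJ k (g h : Aut) : St k g -> St k (h^-1 * (g * h))%g.
Proof.
move=> gk v vk; have -> : (h^-1 * (g * h))%g v = (h^-1%g : Aut) (g (h v)) by [].
rewrite gk ?level_aut //.
by have /(congr1 (fun f : Aut => f v)) := mulVg h.
Qed.

(* The group topology for which the St k form a subbase of neighbourhoods of 1;
   they form a base when, as in bounded trees, every vertex has a child. *)
Definition aut_nbhs (g : Aut) : set_system Aut :=
  [set A | exists n, forall s, (forall k, (k <= n)%N -> St k s) -> A (g * s)%g].

HB.instance Definition _ := hasNbhs.Build Aut aut_nbhs.

Lemma aut_nbhs_filter (g : Aut) : ProperFilter (nbhs g).
Proof.
split; first by case=> n /(_ 1%g)[] k _; exact: St1.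
split; first by exists 0%N.
- move=> A B [n nA] [m mB]; exists (maxn n m) => s Ss; split.
    by apply: nA => k kn; apply: Ss; rewrite leq_max kn.
  by apply: mB => k km; apply: Ss; rewrite leq_max km orbT.
- by move=> A B AB [n nA]; exists n => s /nA /AB.
Qed.

Lemma aut_nbhs_singleton (g : Aut) (A : set Aut) : nbhs g A -> A g.
Proof. by case=> n /(_ 1%g); rewrite mulg1; apply=> k _; exact: St1. Qed.

Lemma aut_nbhs_nbhs (g : Aut) (A : set Aut) : nbhs g A -> nbhs g (nbhs^~ A).
Proof.
case=> n nA; exists n => s Ss; exists n => t St_t; rewrite -mulgA; apply: nA.
by move=> k kn; apply: StM; [exact: Ss | exact: St_t].
Qed.

HB.instance Definition _ := Nbhs_isNbhsTopological.Build Aut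
  aut_nbhs_filter aut_nbhs_singleton aut_nbhs_nbhs.

Lemma aut_mulg_continuous : continuous (fun x : Aut * Aut => (x.1 * x.2)%g).
Proof.
case=> g h A [n nA].
exists ([set g * s | s in [set s | forall k, (k <= n)%N -> St k s]]%g,
        [set h * s | s in [set s | forall k, (k <= n)%N -> St k s]]%g) => /=.
  by split; exists n => s Ss; exists s.
case=> _ _ /= [[s Ss <-] [t St_t <-]].
have -> : (g * s * (h * t) = g * h * ((h^-1 * (s * h)) * t))%g.
  by rewrite -!mulgA mulVKg.
by apply: nA => k kn; apply: StM; [apply/StJ/Ss | apply: St_t].
Qed.

Lemma aut_invg_continuous : continuous (fun g : Aut => g^-1%g).
Proof.
move=> g A [n nA]; exists n => s Ss /=.
have -> : ((g * s)^-1 = g^-1 * (g^-1^-1 * (s^-1 * g^-1)))%g.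
  by rewrite invgM invgK mulKg.
by apply: nA => k kn; apply/StJ/StV/Ss.
Qed.

HB.instance Definition _ := Group_isTopologicalGroup.Build Aut
  aut_mulg_continuous aut_invg_continuous.

End RootedTree.

(* The index |H : K|, for K a subgroup of finite index of H: the number of
   left cosets hK with h in H (the value is 0 if that number is infinite). *)
Definition subgroup_index (G : groupType) (H K : set G) : nat :=
  #|` fset_set [set [set (h * x)%g | x in K] | h in H] |.

Local Open Scope ring_scope.

Definition strong_zero_hausdorff_dimension
    (R : realType) (T : rooted_tree) (H : set (Aut T)) : Prop :=
  (fun k : nat => ln (subgroup_index H (H `&` St k))%:R /
                  ln (subgroup_index [set: Aut T] (St k))%:R : R) @ \oo --> (0 : R).

(* Main.v *)
(* Let A_k be the image of H on the N_k vertices of level k and V_k the subgroup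
   of A_k acting trivially on level k - 1. As |A_k| is the product of the |V_j|,
   it is enough that log |V_k| = o(N_k). Say that vertices are negligible if
   the number of restrictions of V_k to them is exp(o(N_k)).

   By induction on the length of a reduced word, all but negligibly many vertices
   x are sent by the word, evaluated at a uniformly random tuple of A_k, to each
   given vertex with small probability. For a law, which sends x to x, this says
   that all the vertices are negligible.

   Inductive step for the word a s. Let x_0, ..., x_i be the path of x_0 = x
   along s. If some v in V_k fixes x_0, ..., x_(i-1) and moves x_i, then twisting
   the generator of a by v moves the end of the path of a s within its fibre over
   level k - 1 and nothing else, so the concentration is halved at such a level;
   as it is bounded, this happens at few levels for each vertex. Otherwise x_i is
   determined by x_0, ..., x_(i-1), in the sense that its stabilizer in V_k
   contains theirs. If this has probability at least kappa, read the paths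
   backwards: x is determined by the other vertices of a random backward path
   ending at x, and by induction many of these paths are pairwise disjoint off x.
   Hence a sparse random set of vertices determines nearly all such x, which are
   therefore negligible. *)
Require Import Defs.
From HB Require Import structures.
From mathcomp Require Import all_boot all_order all_algebra fingroup perm.
From mathcomp Require Import finmap.
From mathcomp Require Import all_classical all_reals all_analysis.
From mathcomp Require Import zify ring lra.
Import numFieldNormedType.Exports.

Set Implicit Arguments.
Unset Strict Implicit.
Unset Printing Implicit Defensive.

(** * Random paths and entropy in a tower of permutation groups *)

Section Trajectories.
Variables (r : nat) (X : finType).
Implicit Types (p : {ffun 'I_r -> {perm X}}) (a b : letter r).
Implicit Types (s t : seq (letter r)) (x y z : X) (V A : {set {perm X}}).

Definition lperm p a : {perm X} := if a.2 then (p a.1)^-1%g else p a.1.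

Definition ev p s x : X := foldr (fun a => lperm p a) x s.

(* The points that the path of [x] along [s] visits before its end. *)
Fixpoint traj p s x : seq X :=
  if s is _ :: s' then ev p s' x :: traj p s' x else [::].

(** For a group [V] this means that the values of an element of [V] on [Y] determine its value at
    [x]. *)
Definition dep V (Y : seq X) x : bool :=
  [forall v in V, all (fun y => v y == y) Y ==> (v x == x)].

Definition returns V p s x : bool := dep V (traj p s x) (ev p s x).

Definition tuples A : {set {ffun 'I_r -> {perm X}}} :=
  [set p : {ffun 'I_r -> {perm X}} | [forall i, p i \in A]].

(** A product in [{perm X}] applies its left factor first, hence the tail of the word on the
    left. *)
Fixpoint evp p s : {perm X} :=
  if s is a :: s' then (evp p s' * lperm p a)%g else 1%g.

Lemma evpE p s x : evp p s x = ev p s x.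
Proof. by elim: s => [|a s IH] /=; rewrite ?perm1 // permM IH. Qed.

Lemma ev_cat p s t x : ev p (s ++ t) x = ev p s (ev p t x).
Proof. by rewrite /ev foldr_cat. Qed.

Lemma lpermV p a : lperm p (linv a) = (lperm p a)^-1%g.
Proof. by case: a => i []; rewrite /lperm /= ?invgK. Qed.

Lemma word_inv_cons a s : word_inv (a :: s) = word_inv s ++ [:: linv a].
Proof. by rewrite /word_inv /= rev_cons cats1. Qed.

Lemma ev_word_invK p s : cancel (ev p (word_inv s)) (ev p s).
Proof.
elim: s => [|a s IH] x //.
by rewrite word_inv_cons ev_cat /= IH lpermV permKV.
Qed.

Lemma ev_word_inv p s x : ev p (word_inv s) x = (evp p s)^-1%g x.
Proof.
by apply: (@perm_inj _ (evp p s)); rewrite evpE ev_word_invK permKV.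
Qed.

(** The path that starts at [ev p (word_inv s) x] ends at [x], so each vertex on it is reached from
    [x] by inverting the prefix of [s] that remains to be applied. Concentration bounds for these
    inverted prefixes thus control the path. *)
Lemma traj_backward p s x :
  traj p s (ev p (word_inv s) x) =
  [seq ev p (word_inv (take j s)) x | j <- iota 1 (size s)].
Proof.
elim: s x => [|a s IH] x //=.
rewrite word_inv_cons ev_cat /= ev_word_invK IH take0 /=; congr (_ :: _).
rewrite (iotaDl 1 1) -map_comp; apply: eq_map => j /=.
by rewrite word_inv_cons ev_cat.
Qed.

Lemma evp_conj p u s : evp [ffun i => p i ^ u]%g s = (evp p s ^ u)%g.
Proof.
elim: s => [|a s IH] /=; first by rewrite conj1g.
rewrite IH conjMg /lperm; case: a => i [] //=; rewrite ffunE //.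
by rewrite conjVg.
Qed.

Lemma ev_conj p u s x : ev [ffun i => p i ^ u]%g s (u x) = u (ev p s x).
Proof. by rewrite -!evpE evp_conj permJ. Qed.

Lemma traj_conj p u s x :
  traj [ffun i => p i ^ u]%g s (u x) = map u (traj p s x).
Proof. by elim: s => //= a s ->; rewrite ev_conj. Qed.

Lemma dep_conj V (u : {perm X}) (Y : seq X) x :
  u \in 'N(V)%g -> dep V (map u Y) (u x) = dep V Y x.
Proof.
move=> uN; apply/forall_inP/forall_inP => H v vV; apply/implyP => fixY.
  have vu : (v ^ u)%g \in V by rewrite memJ_norm.
  have := H _ vu; rewrite permJ (inj_eq perm_inj) => /implyP; apply.
  apply/allP => _ /mapP[y yY ->]; rewrite permJ.
  by rewrite (eqP (allP fixY _ yY)).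
have vu : (v ^ u^-1)%g \in V by rewrite memJ_norm // groupV.
have vE z : (v ^ u^-1)%g z = (u^-1)%g (v (u z)).
  by rewrite conjgE invgK !permM.
have := H _ vu; rewrite vE => /implyP H'.
rewrite -(inj_eq (@perm_inj _ u^-1%g)) (permK u); apply: H'.
apply/allP => y yY; rewrite vE -(inj_eq (@perm_inj _ u)) permKV.
by apply: (allP fixY); apply: map_f.
Qed.

Lemma returns_conj V p u s x :
  u \in 'N(V)%g -> returns V [ffun i => p i ^ u]%g s (u x) = returns V p s x.
Proof. by move=> uN; rewrite /returns traj_conj ev_conj dep_conj. Qed.

Lemma tuplesP (A : {set {perm X}}) p :
  reflect (forall i, p i \in A) (p \in tuples A).
Proof. by rewrite inE; apply: forallP. Qed.

Lemma lperm_in (A : {group {perm X}}) p a : p \in tuples A -> lperm p a \in A.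
Proof. by move/tuplesP => pA; rewrite /lperm; case: a.2; rewrite ?groupV. Qed.

Lemma evp_in (A : {group {perm X}}) p s : p \in tuples A -> evp p s \in A.
Proof. by move=> pA; elim: s => //= a s IH; rewrite groupM // lperm_in. Qed.

Lemma card_tuples (A : {set {perm X}}) : #|tuples A| = (#|A| ^ r)%N.
Proof.
rewrite -[X in (_ ^ X)%N](card_ord r) -(card_ffun_on 'I_r A).
by apply: eq_card => p; rewrite inE.
Qed.

(* Conjugating [p] by the inverse of its own value on [s] turns the path
   starting at [x] into the one ending at [x]. *)
Lemma card_returns_backward (A : {group {perm X}}) V s x :
  A \subset 'N(V)%g ->
  (#|[set p in tuples A | returns V p s x]| <=
   #|[set p in tuples A | dep V (traj p s (ev p (word_inv s) x)) x]|)%N.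
Proof.
move=> nV; pose psi p := [ffun i => p i ^ (evp p s)^-1]%g.
(* [evp p s] commutes with itself, so it survives the conjugation, and [p] can be recovered from
   [psi p]. *)
have evpsi p : evp (psi p) s = evp p s by rewrite evp_conj conjgE invgK mulgV mulg1.
have psi_inj : injective psi.
  move=> p q epq; have euv : evp p s = evp q s by rewrite -(evpsi p) epq evpsi.
  apply/ffunP => i; have := congr1 (fun f : {ffun _ -> _} => f i) epq.
  by rewrite !ffunE euv; apply: conjg_inj.
rewrite -(card_imset _ psi_inj); apply: subset_leq_card.
apply/fintype.subsetP => q /imsetP[p]; rewrite inE => /andP[pA ret] ->.
have uA := evp_in s pA; rewrite inE; apply/andP; split.
  apply/tuplesP => i; rewrite ffunE groupJ ?groupV //.
  by move/tuplesP: pA; apply.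
rewrite -(returns_conj p s x (fintype.subsetP nV _ (groupVr uA))) in ret.
move: ret; rewrite -/(psi p) /returns; congr (dep _ (traj _ _ _) _).
  by rewrite ev_word_inv evpsi.
by rewrite -evpE evpsi permKV.
Qed.

End Trajectories.

Arguments tuples {r X} A.

(** * Twisting one generator *)

Section Modification.
Variables (r : nat) (X : finType).
Implicit Types (p : {ffun 'I_r -> {perm X}}) (a b : letter r).
Implicit Types (s t : seq (letter r)) (x y z : X) (u v q : {perm X}).

(** Arranged so that [a], whether a generator or an inverse, becomes [v] followed by the old [a]. *)
Definition modify p a (v : {perm X}) : {ffun 'I_r -> {perm X}} :=
  [ffun i => if i == a.1 then if a.2 then p i * v^-1 else v * p i else p i]%g.

Lemma lperm_modify p a v b :
  lperm (modify p a v) b =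
  (if b == a then v * lperm p a
   else if b == linv a then lperm p b * v^-1 else lperm p b)%g.
Proof.
case: a b => i e [j f]; rewrite /lperm /modify /linv !ffunE !xpair_eqE /=.
by case: eqP => [->|_] //=; case: e f => [] [] //=; rewrite ?invMg ?invgK.
Qed.

Lemma modify_inj a v : injective (fun p => modify p a v).
Proof.
move=> p q epq; apply/ffunP => i.
have := congr1 (fun f : {ffun _ -> _} => f i) epq; rewrite !ffunE.
by case: (i == a.1); case: a.2 => //; [apply: mulIg | apply: mulgI].
Qed.

(** The new [a] applies [v] first and the new [linv a] applies its inverse last; at visited vertices
    this has no effect. Only a leading [linv a] could move the end of the path, and reducedness of
    [a :: s] excludes it. *)
Lemma ev_modify p a v s x :
  reduced (a :: s) -> all (fun y => v y == y) (traj p s x) ->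
  ev (modify p a v) s x = ev p s x /\ traj (modify p a v) s x = traj p s x.
Proof.
have main t : all (fun y => v y == y) (traj p t x) ->
    (forall t', t = linv a :: t' -> v (ev p t x) = ev p t x) ->
  ev (modify p a v) t x = ev p t x /\ traj (modify p a v) t x = traj p t x.
  elim: t => //= b t IH /andP[/eqP vt fixt] hb.
  have [-> ->] := IH fixt (fun _ _ => vt); split=> //.
  rewrite lperm_modify; case: (b =P a) => [->|_]; first by rewrite permM vt.
  case: (b =P linv a) => [eb|//]; rewrite permM; apply: (@perm_inj _ v).
  by rewrite permKV (hb t) ?eb.
move=> red fixs; apply: main => // t' es; move: red.
by rewrite es /reduced /= linvK eqxx.
Qed.

(* If some [v] in [V] fixes the vertices visited before the last one but moves
   the last one, replacing the last letter [g] by [g * v] changes the end of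
   the path inside its fibre, so that end is in each vertex of its fibre at
   most half of the time. *)
Lemma card_escape (A V : {group {perm X}}) (Y : finType) (f : X -> Y) a s x y :
  V \subset A -> (forall v x', v \in V -> f (v x') = f x') ->
  (forall q x' x'', q \in A -> f x' = f x'' -> f (q x') = f (q x'')) ->
  reduced (a :: s) ->
  (2 * #|[set p in tuples A | (ev p (a :: s) x == y) & ~~ returns V p s x]| <=
   #|[set p in tuples A | f (ev p (a :: s) x) == f y]|)%N.
Proof.
move=> /fintype.subsetP VA fV fA red.
pose bad Z z v := [&& v \in V, all (fun z => v z == z) Z & v z != z].
(* The twist is chosen from the path alone, which it leaves unchanged; this makes [psi] injective on
   [S]. The default is taken only when the path returns. *)
pose c (Z : seq X) (z : X) := odflt 1%g [pick v | bad Z z v].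
have cV Z z : c Z z \in V.
  by rewrite /c; case: pickP => [v /and3P[]|_] //=; rewrite group1.
have cP Z z : ~~ dep V Z z -> bad Z z (c Z z).
  rewrite /c; case: pickP => [v //|none] /forall_inPn[v vV].
  by rewrite negb_imply => /andP[fx nfx]; have := none v; rewrite /bad vV fx nfx.
pose psi p := modify p a (c (traj p s x) (ev p s x)).
set S := finset _; set S' := finset _.
have SA p : p \in S -> [/\ p \in tuples A, ev p (a :: s) x = y
    & bad (traj p s x) (ev p s x) (c (traj p s x) (ev p s x))].
  by rewrite inE => /and3P[pA /eqP ey nret]; split=> //; apply: cP.
have psiE p : p \in S -> ev (psi p) s x = ev p s x /\
    traj (psi p) s x = traj p s x.
  by case/SA => _ _ /and3P[_ fixp _]; apply: ev_modify.
have psi_inj : {in S &, injective psi}.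
  move=> p q pS qS epq; have [ep tp] := psiE p pS; have [eq tq] := psiE q qS.
  have e1 : ev p s x = ev q s x by rewrite -ep -eq epq.
  have e2 : traj p s x = traj q s x by rewrite -tp -tq epq.
  by move: epq; rewrite /psi e1 e2 => /modify_inj.
have psiA p : p \in S -> psi p \in tuples A.
  case/SA => /tuplesP pA _ _; apply/tuplesP => i; rewrite ffunE.
  case: (i == a.1); case: a.2; rewrite ?groupM // ?groupV ?VA //.
have psiend p : p \in S -> ev (psi p) (a :: s) x =
    lperm p a (c (traj p s x) (ev p s x) (ev p s x)).
  move=> pS; have [/= -> _] := psiE p pS.
  by rewrite lperm_modify eqxx permM.
(* Paths from [S] end at [y]; after [psi] they do not, as the twist moves the vertex to which the
   last letter is applied. *)
have dis : [disjoint S & psi @: S].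
  rewrite disjoint_sym; apply/pred0P => q /=; apply/negP => /andP[].
  case/imsetP => p pS ->; rewrite inE psiend // => /and3P[_ /eqP].
  have [_ <- /and3P[_ _ ne]] := SA p pS.
  by move=> /perm_inj e; rewrite e eqxx in ne.
have -> : (2 * #|S| = #|S :|: psi @: S|)%N.
  by rewrite cardsU disjoint_setI0 // cards0 subn0 card_in_imset // mul2n addnn.
apply: subset_leq_card; apply/fintype.subsetP => q; rewrite inE => /orP[qS|].
  by have [qA ey _] := SA q qS; rewrite inE qA /= -ey eqxx.
case/imsetP => p pS ->; rewrite inE psiA // psiend //=; apply/eqP.
have [pA <- _] := SA p pS; apply: (fA); first exact: lperm_in.
by rewrite fV.
Qed.

End Modification.

(** * Uniform tuples in an extension of permutation groups *)

Section Covering.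
Variables (r : nat) (X Y : finType) (f : X -> Y).
Variables (A V : {group {perm X}}) (B : {group {perm Y}}).
Implicit Types (a v : {perm X}) (b : {perm Y}).
Hypothesis f_surj : forall y, exists x, f x = y.
Hypothesis VP : forall v,
  reflect (v \in A /\ forall x, f (v x) = f x) (v \in V).
Hypothesis descend : forall a, a \in A ->
  exists2 b, b \in B & forall x, f (a x) = b (f x).
Hypothesis lift : forall b, b \in B ->
  exists2 a, a \in A & forall x, f (a x) = b (f x).

Definition covers (a : {perm X}) (b : {perm Y}) := [forall x, f (a x) == b (f x)].

Lemma coversP a b : reflect (forall x, f (a x) = b (f x)) (covers a b).
Proof. by apply: (iffP forallP) => H x; apply/eqP; rewrite H. Qed.

Lemma covers_uniq a b b' : covers a b -> covers a b' -> b = b'.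
Proof.
move=> /coversP ab /coversP ab'; apply/permP => y.
by have [x <-] := f_surj y; rewrite -ab -ab'.
Qed.

(** Two lifts of [b] differ by an element of [V], so the lifts form one coset of [V]. *)
Lemma card_fibre b : b \in B -> #|[set a in A | covers a b]| = #|V|.
Proof.
move=> /lift[a0 a0A a0b].
rewrite -[RHS](card_imset _ (@mulIg _ a0)); apply: eq_card => a.
rewrite inE; apply/andP/imsetP => [[aA /coversP ab]|[v /VP[vA vf] ->]].
  exists (a * a0^-1)%g; last by rewrite mulgKV.
  apply/VP; split=> [|x]; first by rewrite groupM ?groupV.
  rewrite permM; have := a0b ((a0^-1)%g (a x)); rewrite permKV ab.
  by move/perm_inj.
by split; [rewrite groupM | apply/coversP => x; rewrite permM a0b vf].
Qed.

Lemma card_extension : #|A| = (#|V| * #|B|)%N.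
Proof.
rewrite -sum1_card (partition_big (fun a => odflt 1%g [pick b in B | covers a b])
  (fun b => b \in B)) /=; last first.
  by move=> a aA; case: pickP => [b /andP[]|_] //=; rewrite group1.
rewrite mulnC -sum_nat_const; apply: eq_bigr => b bB.
rewrite -(card_fibre bB) -sum1_card; apply: eq_bigl => a; rewrite inE.
case aA: (a \in A) => //=; have [b0 b0B /coversP ab0] := descend aA.
case: pickP => [b1 /andP[b1B ab1]|/(_ b0)]; last by rewrite b0B ab0.
by apply/eqP/idP => [<-//|ab]; apply: covers_uniq ab.
Qed.

Lemma ev_covers (p : {ffun 'I_r -> {perm X}}) (q : {ffun 'I_r -> {perm Y}}) s x :
  (forall i, covers (p i) (q i)) -> f (ev p s x) = ev q s (f x).
Proof.
move=> pq; elim: s => //= -[i e] s <-; rewrite /lperm /=.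
have /coversP H := pq i; case: e => //=.
by apply: (@perm_inj _ (q i)); rewrite -H !permKV.
Qed.

(** Each tuple of [B] has exactly [#|V| ^ r] lifts, so a uniform tuple of [A] projects to a uniform
    tuple of [B]. The two probabilities are compared by cross-multiplication. *)
Lemma card_covering_tuples (s : seq (letter r)) x y :
  (#|[set p in tuples A | f (ev p s x) == f y]| * #|@tuples r _ B| =
   #|[set q in tuples B | ev q s (f x) == f y]| * #|@tuples r _ A|)%N.
Proof.
pose pi (p : {ffun 'I_r -> {perm X}}) : {ffun 'I_r -> {perm Y}} :=
  [ffun i => odflt 1%g [pick b in B | covers (p i) b]].
have piB p : pi p \in tuples B.
  apply/tuplesP => i; rewrite ffunE; case: pickP => [b /andP[]|_] //=.
have pi_cov p i : p \in tuples A -> covers (p i) (pi p i).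
  move/tuplesP => /(_ i) /descend[b bB /coversP pb]; rewrite ffunE.
  by case: pickP => [b' /andP[]|/(_ b)] //; rewrite bB pb.
have fib q : q \in tuples B -> #|[set p in tuples A | pi p == q]| = (#|V| ^ r)%N.
  move/tuplesP => qB; rewrite -[X in (_ ^ X)%N](card_ord r) -prod_nat_const.
  rewrite (eq_bigr (fun i => #|[set a in A | covers a (q i)]|)); last first.
    by move=> i _; rewrite card_fibre.
  transitivity #|family (fun i => mem [set a in A | covers a (q i)])|.
    apply: eq_card => p; rewrite inE; apply/andP/familyP => [[pA /eqP <-] i|pq].
      by rewrite inE (pi_cov _ _ pA) andbT; apply/tuplesP.
    have pA : p \in tuples A.
      by apply/tuplesP => i; have := pq i; rewrite inE => /andP[].
    split=> //; apply/eqP/ffunP => i; have := pq i; rewrite inE => /andP[_].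
    exact: covers_uniq (pi_cov _ _ pA).
  by rewrite card_family foldrE big_map big_enum.
have count (E : pred {ffun 'I_r -> {perm Y}}) :
    #|[set p in tuples A | E (pi p)]| = (#|[set q in tuples B | E q]| * #|V| ^ r)%N.
  rewrite -sum1_card (partition_big pi (fun q => q \in [set q in tuples B | E q]))
    /=; last by move=> p; rewrite !inE => /andP[_ ->]; have := piB p; rewrite inE => ->.
  rewrite -sum_nat_const; apply: eq_bigr => q; rewrite inE => /andP[qB Eq].
  rewrite -(fib _ qB) -sum1_card; apply: eq_bigl => p; rewrite !inE.
  by case: eqP => [->|]; rewrite ?Eq ?andbF ?andbT.
have cA : #|@tuples r _ A| = (#|@tuples r _ B| * #|V| ^ r)%N.
  have := count xpredT; rewrite (_ : [set p in tuples A | _] = @tuples r _ A) => [->|].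
    by congr (_ * _)%N; apply: eq_card => q; rewrite inE andbT.
  by apply/setP => q; rewrite inE andbT.
rewrite (_ : [set p in tuples A | _] =
  [set p in tuples A | ev (pi p) s (f x) == f y]); last first.
  apply/setP => p; rewrite !finset.in_set; case pA: [forall i, _] => //=.
  rewrite (@ev_covers p (pi p)) // => i; apply: pi_cov.
  by rewrite inE.
by rewrite (count (fun q => ev q s (f x) == f y)) cA; lia.
Qed.

End Covering.

Lemma card_family_prod (X Y : finType) (F : X -> {pred Y}) :
  #|family F| = (\prod_x #|F x|)%N.
Proof. by rewrite card_family foldrE big_map big_enum. Qed.

(** * Sparse random sets that include a member of most families *)

Section RandomHitting.
Variables (X : finType) (q : nat).
Local Notation colouring := {ffun X -> 'I_q.+1}.
Implicit Types (phi : colouring) (P : {set X}) (F : seq {set X}).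

Definition colour0 phi : {set X} := [set x | phi x == ord0].

Definition recolour phi P : colouring := [ffun x => if x \in P then ord0 else phi x].

Definition avoiding F : {set colouring} :=
  [set phi | ~~ has (fun P : {set X} => P \subset colour0 phi) F].

Lemma card_recolour_fibre phi0 P :
  (#|[set phi | recolour phi P == phi0]| <= q.+1 ^ #|P|)%N.
Proof.
pose G x : {pred 'I_q.+1} := if x \in P then predT else pred1 (phi0 x).
have -> : (q.+1 ^ #|P| = #|family G|)%N.
  rewrite card_family_prod (bigID (mem P)) /= [X in (_ * X)%N]big1; last first.
    by move=> x /negPf xP; rewrite /G xP card1.
  rewrite muln1 (eq_bigr (fun=> q.+1)) ?prod_nat_const // => x xP.
  by rewrite /G xP card_ord.
apply: subset_leq_card; apply/fintype.subsetP => phi; rewrite inE => /eqP e.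
by apply/familyP => x; rewrite /G -e ffunE; case: (x \in P); rewrite inE ?eqxx.
Qed.

(** With [Q = q.+1 ^ n], the bound is a probability [(1 - 1/Q) ^ size F]. Recolouring [P] by colour
    0 is at most [Q] to one and, by disjointness, creates no inclusion of another set; hence, given
    that the others are avoided, [P] is included with probability at least [1/Q]. *)
Lemma card_avoiding n F :
  pairwise (fun P P' : {set X} => [disjoint P & P']) F ->
  all (fun P : {set X} => #|P| <= n)%N F ->
  (#|avoiding F| * (q.+1 ^ n) ^ size F <=
   (q.+1 ^ n).-1 ^ size F * q.+1 ^ #|X|)%N.
Proof.
elim: F => [|P F IH] /=.
  move=> _ _; rewrite !expn0 mul1n muln1.
  by rewrite -[in X in (_ <= X)%N](card_ord q.+1) -card_ffun max_card.
move=> /andP[disP disF] /andP[cP cF]; have {IH} := IH disF cF.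
set S := avoiding F; set S1 := avoiding _; set Q := (q.+1 ^ n)%N => IH.
pose E := [set phi in S | P \subset colour0 phi].
have Q0 : (0 < Q)%N by rewrite expn_gt0.
have SE : #|S| = (#|S1| + #|E|)%N.
  rewrite -(cardsID E S) addnC; congr (_ + _)%N; apply: eq_card => phi.
    by rewrite !inE /= negb_or; case: (has _ _); rewrite ?andbF ?andbT.
  by rewrite !inE; case: (has _ _).
have recE phi : phi \in S -> recolour phi P \in E.
  rewrite !inE => nphi; apply/andP; split; last first.
    by apply/fintype.subsetP => x xP; rewrite inE ffunE xP.
  apply: contra nphi => /hasP[P' P'F sub]; apply/hasP; exists P' => //.
  apply/fintype.subsetP => x xP'; have := fintype.subsetP sub x xP'.
  rewrite !inE ffunE; case: ifP => // xP _.
  by have /pred0P/(_ x) := allP disP _ P'F; rewrite /= xP xP'.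
have SQ : (#|S| <= Q * #|E|)%N.
  rewrite -sum1_card (partition_big (fun phi => recolour phi P) (mem E)) /=; last first.
    by move=> phi; apply: recE.
  rewrite mulnC -sum_nat_const; apply: leq_sum => e _.
  apply: leq_trans (_ : #|[set phi | recolour phi P == e]| <= _)%N; last first.
    by rewrite (leq_trans (card_recolour_fibre _ _)) // leq_pexp2l.
  rewrite sum1_card; apply: subset_leq_card; apply/fintype.subsetP => phi.
  by rewrite inE; case/andP.
have S1Q : (#|S1| * Q <= Q.-1 * #|S|)%N.
  by rewrite -subn1 mulnBl mul1n {1}SE mulnDr; nia.
rewrite !expnS mulnA.
apply: (leq_trans (leq_mul S1Q (leqnn _))).
by rewrite -!mulnA leq_mul2l IH orbT.
Qed.

Lemma card_colour0 x : (q.+1 * #|[set phi : colouring | phi x == ord0]| = q.+1 ^ #|X|)%N.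
Proof.
pose G y : {pred 'I_q.+1} := if y == x then pred1 ord0 else predT.
have -> : #|[set phi : colouring | phi x == ord0]| = #|family G|.
  apply: eq_card => phi; rewrite inE; apply/eqP/familyP => [e y|/(_ x)].
    by rewrite /G; case: eqP => [->|_]; rewrite inE ?e.
  by rewrite /G eqxx inE => /eqP.
rewrite card_family_prod (bigD1 x) //= {1}/G eqxx card1 mul1n.
have -> : (q.+1 ^ #|X| = \prod_(y : X) q.+1)%N by rewrite prod_nat_const.
rewrite [RHS](bigD1 x) //=; congr (_ * _)%N; apply: eq_bigr => y /negPf yx.
by rewrite /G yx card_ord.
Qed.

(* For a uniformly random [phi], [colour0 phi] has density [1 / q.+1] and
   includes one of [t] disjoint small sets with high probability. *)
Lemma random_hitting (C : {set X}) (F : X -> seq {set X}) n t :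
  ((q.+1 ^ n).-1 ^ t * q.+1 <= (q.+1 ^ n) ^ t)%N ->
  (forall x, x \in C -> [/\ size (F x) = t,
    pairwise (fun P P' : {set X} => [disjoint P & P']) (F x) &
    all (fun P : {set X} => #|P| <= n)%N (F x)]) ->
  exists R : {set X},
  (q.+1 * (#|R| + #|[set x in C | ~~ has (fun P => P \subset R) (F x)]|)
   <= 2 * #|X|)%N.
Proof.
move=> ht hF; pose D phi := [set x in C | ~~ has (fun P => P \subset colour0 phi) (F x)].
suff [phi Hphi] : exists phi, (q.+1 * (#|colour0 phi| + #|D phi|) <= 2 * #|X|)%N.
  by exists (colour0 phi).
(* First moment: the average of [#|colour0 phi|] is [#|X| / q.+1], and by [ht] that of [#|D phi|] is
   at most as much. Not every colouring can exceed the average. *)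
apply: contrapT => /forallNP H.
have cphi : #|{: colouring}| = (q.+1 ^ #|X|)%N by rewrite card_ffun card_ord.
have c0 : (\sum_phi q.+1 * #|colour0 phi| = #|X| * q.+1 ^ #|X|)%N.
  rewrite -big_distrr /=.
  rewrite (eq_bigr (fun phi => \sum_x (phi x == ord0)))%N; last first.
    move=> phi _; rewrite -sum1_card big_mkcond; apply: eq_bigr => x _.
    by rewrite inE; case: eqP.
  rewrite exchange_big big_distrr /= -sum_nat_const; apply: eq_bigr => x _.
  rewrite -(card_colour0 x) -sum1_card [in RHS]big_mkcond; congr (_ * _)%N.
  by apply: eq_bigr => phi _; rewrite inE; case: eqP.
have cD : (\sum_phi q.+1 * #|D phi| <= #|X| * q.+1 ^ #|X|)%N.
  rewrite -big_distrr /=.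
  rewrite (eq_bigr (fun phi => \sum_(x in C) (phi \in avoiding (F x))))%N; last first.
    move=> phi _; rewrite -sum1_card big_mkcond [RHS]big_mkcond.
    by apply: eq_bigr => x _; rewrite !inE; case: (x \in C); case: has.
  rewrite exchange_big big_distrr /=.
  apply: (@leq_trans (\sum_(x in C) q.+1 ^ #|X|)%N); last first.
    by rewrite sum_nat_const leq_mul2r max_card orbT.
  apply: leq_sum => x xC; have [st dis cn] := hF x xC.
  rewrite -big_mkcond /= sum1_card.
  have := card_avoiding dis cn; rewrite st => le1.
  have Q0 : (0 < (q.+1 ^ n) ^ t)%N by rewrite !expn_gt0.
  rewrite -(leq_pmul2r Q0) -mulnA.
  apply: (leq_trans (leq_mul (leqnn _) le1)).
  by rewrite mulnA (mulnC (q.+1)) (mulnC (q.+1 ^ #|X|)%N) leq_mul2r ht orbT.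
have : (\sum_(phi : colouring) (2 * #|X|).+1 <=
  \sum_(phi : colouring) q.+1 * (#|colour0 phi| + #|D phi|))%N.
  by apply: leq_sum => phi _; rewrite ltnNge; apply/negP/H.
rewrite sum_nat_const cphi.
under eq_bigr do rewrite mulnDr.
rewrite big_split /= c0 => le1.
have : (0 < q.+1 ^ #|X|)%N by rewrite expn_gt0.
have := leq_trans le1 (leq_add (leqnn _) cD).
by move: (q.+1 ^ #|X|)%N #|X| => T a; nia.
Qed.

Lemma enough_trials n : exists t, ((q.+1 ^ n).-1 ^ t * q.+1 <= (q.+1 ^ n) ^ t)%N.
Proof.
have : (0 < q.+1 ^ n)%N by rewrite expn_gt0.
case: (q.+1 ^ n)%N => // b _ /=.
(* Bernoulli's inequality for [(1 + 1/b) ^ t], multiplied out so that [b = 0] is included. *)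
have bern t : (b ^ t * (b + t) <= b.+1 ^ t * b)%N.
  elim: t => [|t IH]; first by rewrite addn0.
  have : (b ^ t <= b.+1 ^ t)%N by case: (t) => // t'; rewrite leq_exp2r.
  by rewrite !expnS; nia.
case: b bern => [|b] bern; first by exists 1%N.
exists (q.+1 * b.+1)%N; have := bern (q.+1 * b.+1)%N.
rewrite (_ : b.+1 + q.+1 * b.+1 = q.+2 * b.+1)%N; last by lia.
by rewrite mulnA leq_pmul2r // => /(leq_trans _); apply; rewrite leq_mul.
Qed.


End RandomHitting.

(** * Counting restrictions of a permutation group *)

Section Traces.
Variables (X : finType) (V : {group {perm X}}).
Implicit Types (C D : {set X}) (u v : {perm X}).

(** Extended by the identity outside [C], so that restrictions to different sets have one type. *)
Definition trace C v : {ffun X -> X} := [ffun x => if x \in C then v x else x].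

Definition traces C : {set {ffun X -> X}} := [set trace C v | v in V].

Lemma trace_eqP C u v : trace C u = trace C v <-> {in C, u =1 v}.
Proof.
split=> [euv x xC|euv]; last first.
  by apply/ffunP => x; rewrite !ffunE; case: ifP => // /euv.
by have := congr1 (fun f : {ffun _ -> _} => f x) euv; rewrite !ffunE xC.
Qed.

Lemma card_traces_determined C D :
  {in V &, forall u v, {in D, u =1 v} -> {in C, u =1 v}} ->
  (#|traces C| <= #|traces D|)%N.
Proof.
move=> det.
pose g (w : {ffun X -> X}) := trace C (odflt 1%g [pick v in V | trace D v == w]).
apply: leq_trans (leq_imset_card g _); apply: subset_leq_card.
apply/fintype.subsetP => _ /imsetP[v vV ->]; apply/imsetP.
exists (trace D v); first exact: imset_f.
apply/trace_eqP; case: pickP => [u /andP[uV /eqP/trace_eqP uv]|/(_ v)] /=.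
  by apply: det => // x xD; rewrite uv.
by rewrite vV eqxx.
Qed.

Lemma card_tracesS C D : C \subset D -> (#|traces C| <= #|traces D|)%N.
Proof.
move=> /fintype.subsetP CD; apply: card_traces_determined => u v _ _ uv x /CD.
exact: uv.
Qed.

Lemma card_tracesU C D : (#|traces (C :|: D)| <= #|traces C| * #|traces D|)%N.
Proof.
pose g (w : {ffun X -> X} * {ffun X -> X}) : {ffun X -> X} :=
  [ffun x => if x \in C then w.1 x else w.2 x].
rewrite -cardsX; apply: leq_trans (leq_imset_card g _); apply: subset_leq_card.
apply/fintype.subsetP => _ /imsetP[v vV ->]; apply/imsetP.
exists (trace C v, trace D v); first by rewrite inE /= !imset_f.
by apply/ffunP => x; rewrite !ffunE /= !inE; case: (x \in C).
Qed.

Lemma card_traces_gt0 C : (0 < #|traces C|)%N.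
Proof.
by apply/card_gt0P; exists (trace C 1%g); apply: imset_f; apply: group1.
Qed.

Lemma card_tracesT : #|traces [set: X]| = #|V|.
Proof.
apply: card_in_imset => u v _ _ /trace_eqP uv; apply/permP => x.
by apply: uv; rewrite inE.
Qed.

Lemma card_traces_fibre (Y : finType) (f : X -> Y) M C :
  {in V, forall v x, f (v x) = f x} ->
  (forall y, #|[set x | f x == y]| <= M)%N ->
  (#|traces C| <= M ^ #|C|)%N.
Proof.
move=> fV fM; pose G x : {pred X} := fun x' => if x \in C then f x' == f x else x' == x.
apply: (@leq_trans #|family G|).
  apply: subset_leq_card; apply/fintype.subsetP => _ /imsetP[v vV ->].
  apply/familyP => x; rewrite ffunE unfold_in /G /=; case: (x \in C) => //.
  by rewrite fV.
rewrite card_family_prod (bigID (mem C)) /= [X in (_ * X)%N]big1 ?muln1; last first.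
  move=> x /negPf xC; rewrite -(card1 x); apply: eq_card => x'.
  by rewrite /G inE /= -topredE /= xC.
rewrite -prod_nat_const; apply: leq_prod => x xC.
apply: leq_trans (fM (f x)); apply: subset_leq_card; apply/fintype.subsetP => x'.
by rewrite /G -topredE /= xC inE.
Qed.

(** If two elements of [V] agree on [D], their quotient fixes [P] pointwise and therefore fixes
    [x]. *)
Lemma traces_dep C D :
  {in C, forall x, exists2 P : {set X}, P \subset D & dep V (enum P) x} ->
  (#|traces C| <= #|traces D|)%N.
Proof.
move=> hC; apply: card_traces_determined => u v uV vV uv x /hC[P PD].
move=> /forall_inP /(_ (v * u^-1)%g); rewrite groupM ?groupV // => /(_ isT).
move=> /implyP H; have /eqP : (v * u^-1)%g x == x; last first.
  by rewrite permM => /(congr1 u); rewrite permKV.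
apply: H; apply/allP => y; rewrite mem_enum => yP.
by rewrite permM -(uv y (fintype.subsetP PD y yP)) permK.
Qed.

End Traces.

Import Order.TTheory GRing.Theory Num.Theory.

(** * Spreading and entropy along a tower of levels *)

Section LevelTower.
Local Open Scope ring_scope.
Variables (R : realType) (r M : nat) (m : nat -> nat) (X : nat -> finType).
Variables (par : forall k, X k.+1 -> X k) (A : forall k, {group {perm X k}}).
Hypothesis m_bounds : forall k, (2 <= m k <= M)%N.
Hypothesis card_children : forall k (y : X k), #|[set x | par x == y]| = m k.
Hypothesis X0_gt0 : (0 < #|X 0|)%N.
Hypothesis descend : forall k a, a \in A k.+1 ->
  exists2 b, b \in A k & forall x, par (a x) = b (par x).
Hypothesis lift : forall k b, b \in A k ->
  exists2 a, a \in A k.+1 & forall x, par (a x) = b (par x).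

Local Notation tuples k := (@tuples r _ (A k)).

Lemma par_surj k (y : X k) : exists x, par x = y.
Proof.
have : (0 < #|[set x | par x == y]|)%N.
  by rewrite card_children; case/andP: (m_bounds k) => /ltnW.
by case/card_gt0P => x; rewrite inE => /eqP; exists x.
Qed.

(** The kernel of [A k.+1] over [A k], which is [V_(k+1)] in the outline. *)
Definition stab k : {set {perm X k.+1}} :=
  [set a in A k.+1 | [forall x, par (a x) == par x]].

Lemma stab_group_set k : group_set (stab k).
Proof.
apply/group_setP; split.
  by rewrite inE group1; apply/forallP => x; rewrite perm1.
move=> a b; rewrite !inE => /andP[aA /forallP ha] /andP[bA /forallP hb].
by rewrite groupM //=; apply/forallP => x; rewrite permM (eqP (hb _)).
Qed.
Canonical stab_group k := Group (stab_group_set k).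

Lemma stabP k v :
  reflect (v \in A k.+1 /\ forall x, par (v x) = par x) (v \in stab k).
Proof.
rewrite inE; apply: (iffP andP) => -[vA H]; split=> //.
  by move=> x; apply/eqP/(forallP H).
by apply/forallP => x; apply/eqP.
Qed.

Lemma stab_sub k : stab k \subset A k.+1.
Proof. by apply/fintype.subsetP => v /stabP[]. Qed.

Lemma par_act k a (x x' : X k.+1) : a \in A k.+1 -> par x = par x' ->
  par (a x) = par (a x').
Proof. by move=> /descend[b _ ab] e; rewrite !ab e. Qed.

Lemma stab_normal k : A k.+1 \subset 'N(stab k)%g.
Proof.
apply/normsP => a aA; apply/setP => v; rewrite mem_conjg.
have main b w : b \in A k.+1 -> w \in stab k -> (w ^ b)%g \in stab k.
  move=> bA /stabP[wA fw]; apply/stabP; split; first exact: groupJ.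
  move=> x; rewrite conjgE !permM.
  by rewrite (par_act bA (fw _)) permKV.
apply/idP/idP => H; last by apply: main; rewrite ?groupV.
by have := main a _ aA H; rewrite -conjgM mulVg conjg1.
Qed.

Lemma card_level k : #|X k.+1| = (m k * #|X k|)%N.
Proof.
rewrite -sum1_card (partition_big (@par k) xpredT) //= mulnC -sum_nat_const.
apply: eq_bigr => y _; rewrite -(card_children y) -sum1_card.
by apply: eq_bigl => x; rewrite inE.
Qed.

Lemma level_gt0 k : (0 < #|X k|)%N.
Proof.
elim: k => // k IH; rewrite card_level muln_gt0 IH andbT.
by case/andP: (m_bounds k) => /ltnW.
Qed.

Lemma card_tower k : #|A k.+1| = (#|stab k| * #|A k|)%N.
Proof.
exact: (@card_extension _ _ _ (A k.+1) (stab_group k) (A k) (@par_surj k)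
  (@stabP k) (@descend k) (@lift k)).
Qed.

Definition law_prob k t (x y : X k) : R :=
  #|[set p in tuples k | ev p t x == y]|%:R / #|tuples k|%:R.

Lemma tuples_gt0 k : (0 : R) < #|tuples k|%:R.
Proof. by rewrite ltr0n card_tuples expn_gt0 cardG_gt0. Qed.

Lemma law_prob_par k t (x y : X k.+1) :
  #|[set p in tuples k.+1 | par (ev p t x) == par y]|%:R / #|tuples k.+1|%:R
  = law_prob t (par x) (par y).
Proof.
have := @card_covering_tuples r _ _ _ (A k.+1) (stab_group k) (A k)
  (@par_surj k) (@stabP k) (@descend k) (@lift k) t x y.
move=> /(congr1 (fun n : nat => n%:R : R)); rewrite !natrM => e.
by apply/eqP; rewrite /law_prob eqr_div ?lt0r_neq0 ?tuples_gt0 // e.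
Qed.

Lemma law_prob_le_par k t (x y : X k.+1) :
  law_prob t x y <= law_prob t (par x) (par y).
Proof.
rewrite -law_prob_par ler_pM2r ?invr_gt0 ?tuples_gt0 // ler_nat.
apply: subset_leq_card; apply/fintype.subsetP => p.
by rewrite !inE => /andP[-> /eqP ->] /=.
Qed.

Lemma law_prob_le1 k t (x y : X k) : law_prob t x y <= 1.
Proof.
rewrite ler_pdivrMr ?tuples_gt0 // mul1r ler_nat.
by apply: subset_leq_card; apply/fintype.subsetP => p; rewrite inE => /andP[].
Qed.

Definition spread k t (eta : R) : {set X k} :=
  [set x | [forall y, law_prob t x y <= eta]].

(** In base [M] each vertex contributes at most 1, as it moves inside a fibre of at most [M]
    vertices. *)
Definition entropy k (C : {set X k.+1}) : R :=
  ln #|traces (stab_group k) C|%:R / ln M%:R.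

Definition negligible (B : forall k, {set X k.+1}) : Prop :=
  forall delta : R, 0 < delta -> exists k0, forall k, (k0 <= k)%N ->
    entropy (B k) <= delta * #|X k.+1|%:R.

Lemma M_gt1 : (1 < M)%N.
Proof. by case/andP: (m_bounds 0) => /leq_trans; apply. Qed.

Lemma lnM_gt0 : 0 < ln M%:R :> R.
Proof. by rewrite ln_gt0 // ltr1n M_gt1. Qed.

Lemma entropyS k (C D : {set X k.+1}) : C \subset D -> entropy C <= entropy D.
Proof.
move=> CD; rewrite ler_pM2r ?invr_gt0 ?lnM_gt0 // ler_ln ?posrE ?ltr0n ?card_traces_gt0 //.
by rewrite ler_nat card_tracesS.
Qed.

Lemma entropyU k (C D : {set X k.+1}) :
  entropy (C :|: D) <= entropy C + entropy D.
Proof.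
rewrite -mulrDl ler_pM2r ?invr_gt0 ?lnM_gt0 // -lnM ?posrE ?ltr0n ?card_traces_gt0 //.
by rewrite -natrM ler_ln ?posrE ?ltr0n ?muln_gt0 ?card_traces_gt0 // ler_nat card_tracesU.
Qed.

(** Used when [D] determines [C]: the size of [D] alone then bounds the entropy of [C], however
    large [C] is. *)
Lemma entropy_le_of_traces k (C D : {set X k.+1}) :
  (#|traces (stab_group k) C| <= #|traces (stab_group k) D|)%N ->
  entropy C <= #|D|%:R.
Proof.
have M0 : (0 < M)%N by apply: ltnW M_gt1.
move=> CD; rewrite ler_pdivrMr ?lnM_gt0 // mulr_natl -lnXn ?ltr0n //.
rewrite -natrX ler_ln ?posrE ?ltr0n ?card_traces_gt0 // ?expn_gt0 ?M0 //.
rewrite ler_nat (leq_trans CD) //.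
apply: (card_traces_fibre (f := @par k)) => [v /stabP[] //|y].
by rewrite card_children; case/andP: (m_bounds k).
Qed.

Lemma entropy_le_card k (C : {set X k.+1}) : entropy C <= #|C|%:R.
Proof. exact: entropy_le_of_traces. Qed.

Lemma negligible_sub (B B' : forall k, {set X k.+1}) :
  (forall k, B k \subset B' k) -> negligible B' -> negligible B.
Proof.
move=> BB' nB' delta /nB'[k0 hk0]; exists k0 => k /hk0; apply: le_trans.
exact: entropyS.
Qed.

Lemma negligibleU (B B' : forall k, {set X k.+1}) :
  negligible B -> negligible B' -> negligible (fun k => B k :|: B' k).
Proof.
move=> nB nB' delta delta0.
have d2 : 0 < delta / 2 by rewrite divr_gt0.
have [k1 h1] := nB _ d2; have [k2 h2] := nB' _ d2.
exists (maxn k1 k2) => k; rewrite geq_max => /andP[/h1 l1 /h2 l2].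
apply: le_trans (entropyU _ _) _; apply: le_trans (lerD l1 l2) _.
by rewrite -mulrDl -splitr.
Qed.

Lemma negligible_bigU (I : eqType) (js : seq I) (B : I -> forall k, {set X k.+1}) :
  {in js, forall j, negligible (B j)} ->
  negligible (fun k => \bigcup_(j <- js) B j k).
Proof.
elim: js => [_ delta d0|j js IH nB].
  exists 0%N => k _; rewrite big_nil; apply: le_trans (entropy_le_card _) _.
  by rewrite cards0 mulr_ge0 // ltW.
have -> : (fun k => \bigcup_(i <- j :: js) B i k) =
    (fun k => B j k :|: \bigcup_(i <- js) B i k).
  by apply: functional_extensionality_dep => k; rewrite big_cons.
apply: negligibleU; first by apply: nB; rewrite inE eqxx.
by apply: IH => i ijs; apply: nB; rewrite inE ijs orbT.
Qed.

Definition returning k s (kappa : R) : {set X k.+1} :=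
  [set x | kappa * #|tuples k.+1|%:R <
    #|[set p in tuples k.+1 | returns (stab k) p s x]|%:R].

(** Returning paths account for at most [kappa]. For the others [card_escape] gains a factor 2 over
    landing in the fibre of [y], an event whose probability is read off at the parents. *)
Lemma law_prob_escape k a s kappa (x y : X k.+1) : reduced (a :: s) ->
  x \notin returning k s kappa ->
  law_prob (a :: s) x y <= law_prob (a :: s) (par x) (par y) / 2 + kappa.
Proof.
move=> red; rewrite inE -leNgt => ret.
have esc := @card_escape r _ (A k.+1) (stab_group k) _ (@par k) a s x y (stab_sub k)
  (fun v x' vV => proj2 (elimT (stabP v) vV) x')
  (fun q x' x'' => @par_act k q x' x'') red.
rewrite -law_prob_par /law_prob mulrAC -[leRHS](mulfK (lt0r_neq0 (tuples_gt0 k.+1))).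
rewrite ler_pM2r ?invr_gt0 ?tuples_gt0 // mulrDl mulfVK ?lt0r_neq0 ?tuples_gt0 //.
have split_le : (#|[set p in tuples k.+1 | ev p (a :: s) x == y]| <=
  #|[set p in tuples k.+1 | (ev p (a :: s) x == y) && ~~ returns (stab k) p s x]| +
  #|[set p in tuples k.+1 | returns (stab k) p s x]|)%N.
  apply: leq_trans (leq_card_setU _ _); apply: subset_leq_card.
  apply/fintype.subsetP => p; rewrite !inE => /andP[-> ->] /=.
  exact: orNb.
move: esc split_le ret; rewrite -!(ler_nat R) natrM natrD; lra.
Qed.

(** Union bound over the words of [ts] and the vertices of [U]. *)
Lemma card_hits k (ts : seq (seq (letter r))) (U : {set X k}) x (eta : R) :
  all (fun t => x \in spread k t eta) ts ->
  #|[set p in tuples k | has (fun t => ev p t x \in U) ts]|%:R <=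
    (size ts * #|U|)%:R * eta * #|tuples k|%:R.
Proof.
elim: ts => [_|t ts IH /= /andP[xt /IH {}IH]].
  rewrite mul0n !mul0r (_ : finset _ = finset.set0) ?cards0 //.
  by apply/setP => p; rewrite !inE andbF.
rewrite mulSn natrD !mulrDl.
apply: le_trans (lerD _ IH); last first.
  apply: (_ : #|[set p in tuples k | ev p t x \in U]|%:R <= _).
  rewrite -sum1_card (partition_big (fun p => ev p t x) (mem U)) /=; last first.
    by move=> p; rewrite inE => /andP[].
  rewrite natr_sum -mulrA mulr_natl -sumr_const; apply: ler_sum => u uU.
  move: xt; rewrite inE => /forallP /(_ u).
  rewrite /law_prob ler_pdivrMr ?tuples_gt0 //; apply: le_trans.
  rewrite ler_nat sum1_card; apply: subset_leq_card; apply/fintype.subsetP => p.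
  by move=> Hp; rewrite unfold_in /= in Hp; move: Hp; rewrite !inE => /andP[/andP[-> _] ->].
rewrite -natrD ler_nat; apply: leq_trans (leq_card_setU _ _).
apply: subset_leq_card; apply/fintype.subsetP => p; rewrite !inE.
by case/andP=> -> /orP[->|->]; rewrite ?orbT.
Qed.

(* The backward paths from [x] are so little concentrated that they can be chosen
   one after the other, each disjoint from the previous ones. *)
Lemma disjoint_returns k s x (kappa eta : R) t :
  x \in returning k s kappa -> 0 <= eta ->
  (forall j, (0 < j <= size s)%N -> x \in spread k.+1 (word_inv (take j s)) eta) ->
  (size s * (t * size s))%:R * eta <= kappa ->
  exists F : seq {set X k.+1}, [/\ size F = t,
    pairwise (fun P P' : {set X k.+1} => [disjoint P & P']) F,
    all (fun P : {set X k.+1} => #|P| <= size s)%N F &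
    all (fun P : {set X k.+1} => dep (stab k) (enum P) x) F].
Proof.
set n := size s => ret eta0 spr; elim: t => [_|t IH le_t]; first by exists [::].
have [|F [sF dF cF hF]] := IH.
  apply: le_trans le_t; apply: ler_wpM2r => //.
  by rewrite ler_nat leq_mul2l leq_mul2r leqnSn !orbT.
pose U := \bigcup_(P <- F) P.
have cU : (#|U| <= t * n)%N.
  rewrite /U -sF; elim: (F) cF => [|P F' IHF] /=; first by rewrite big_nil cards0.
  case/andP => cP /IHF cF'; rewrite big_cons mulSn.
  by apply: leq_trans (leq_card_setU _ _) (leq_add cP cF').
pose ts := [seq word_inv (take j s) | j <- iota 1 n].
pose good p := dep (stab k) (traj p s (ev p (word_inv s) x)) x.
(* For more than a proportion [kappa] of the tuples the backward path determines [x]. By [card_hits]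
   it meets [U] for at most a proportion [kappa], so some determining path avoids [U]. *)
have [p /and3P[pA gp avoid]] : exists p, [&& p \in tuples k.+1, good p &
    ~~ has (fun t => ev p t x \in U) ts].
  apply/existsP; apply: contraT; rewrite negb_exists => /forallP none.
  move: ret; rewrite inE ltNge => /negP[].
  apply: (@le_trans _ _ #|[set p in tuples k.+1 | good p]|%:R).
    by rewrite ler_nat; apply: card_returns_backward; apply: stab_normal.
  apply: (@le_trans _ _ #|[set p in tuples k.+1 | has (fun t => ev p t x \in U) ts]|%:R).
    rewrite ler_nat; apply: subset_leq_card; apply/fintype.subsetP => p.
    rewrite !inE => /andP[pA gp]; have := none p.
    by rewrite inE pA gp /= negbK.
  apply: le_trans (card_hits _ _) _.
    apply/allP => u /mapP[j]; rewrite mem_iota add1n ltnS => hj ->.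
    exact: spr.
  rewrite ler_pM2r ?tuples_gt0 //; apply: le_trans le_t; apply: ler_wpM2r => //.
  rewrite ler_nat size_map size_iota leq_mul2l (leq_trans cU) ?orbT //.
  by rewrite leq_mul2r leqnSn orbT.
pose P := [set y in traj p s (ev p (word_inv s) x)].
have trajE : traj p s (ev p (word_inv s) x) = [seq ev p t x | t <- ts].
  by rewrite traj_backward -map_comp.
exists (P :: F); split; rewrite /= ?sF ?dF ?cF ?hF ?andbT //.
- apply/allP => P' P'F; apply/pred0P => y /=; apply/negP => /andP[yP yP'].
  move/negP: avoid; apply; move: yP; rewrite inE trajE => /mapP[t' t'ts ey].
  apply/hasP; exists t' => //; rewrite -ey /U.
  by rewrite (big_rem P') //= inE yP'.
- apply: leq_trans (_ : size (traj p s (ev p (word_inv s) x)) <= _)%N.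
    by rewrite cardsE card_size.
  by rewrite trajE !size_map size_iota.
- move: gp; rewrite /good /dep => /forall_inP H; apply/forall_inP => v vV.
  apply/implyP => fixP; apply: (implyP (H v vV)); apply/allP => y yt.
  by apply: (allP fixP); rewrite mem_enum inE.
Qed.

(** The empty word is excluded because it sends [x] to [x] with probability 1. *)
Definition spreads n : Prop := forall t, reduced t -> (0 < size t <= n)%N ->
  forall eta : R, 0 < eta -> negligible (fun k => ~: spread k.+1 t eta).

(** Off a negligible set, each returning vertex is determined by each of [t] disjoint small sets,
    and a sparse set includes one of them for nearly all such vertices. The parameters [q], [t] and
    [eta] do not depend on the level. *)
Lemma returning_negligible n s (kappa : R) : spreads n -> reduced s -> size s = n ->
  0 < kappa -> negligible (fun k => returning k s kappa).
Proof.
move=> spr red sn kappa0 delta delta0.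
(* The hitting set and the missed vertices will together have density at most [2 / q.+1]. *)
have [q hq] : exists q : nat, 2 / q.+1%:R <= delta / 2.
  exists (Num.truncn (4 / delta)); have := truncnS_gt (4 / delta).
  rewrite ltr_pdivrMr // => h.
  rewrite ler_pdivrMr ?ltr0n // mulrAC ler_pdivlMr //; lra.
have [t ht] := enough_trials q n.
(* [n] words against at most [t * n] vertices of earlier paths; the successor in [eta] avoids a
   division by 0. *)
pose c := (n * (t * n))%N; pose eta := kappa / c.+1%:R.
have eta0 : 0 < eta by rewrite divr_gt0 ?ltr0n.
have c_eta : c%:R * eta <= kappa.
  rewrite /eta mulrCA ger_pMr // ler_pdivrMr ?ltr0n // mul1r ler_nat //.
pose bad k := \bigcup_(j <- iota 1 n) ~: spread k.+1 (word_inv (take j s)) eta.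
have nbad : negligible bad.
  apply: negligible_bigU => j; rewrite mem_iota add1n ltnS => /andP[j0 jn].
  apply: spr => //.
    apply: word_inv_reduced; move: red; rewrite -{1}(cat_take_drop j s) /reduced.
    by case/cat_sorted2.
  by rewrite size_rev size_map size_take_min sn (minn_idPl jn) j0.
have d2 : 0 < delta / 2 by rewrite divr_gt0.
have [k0 hk0] := nbad _ d2; exists k0 => k /hk0 {hk0} hbad.
set C := returning k s kappa :\: bad k.
have Csub : returning k s kappa \subset C :|: bad k.
  apply/fintype.subsetP => x; rewrite !inE => ->; rewrite andbT.
  exact: orNb.
apply: le_trans (entropyS Csub) _; apply: le_trans (entropyU _ _) _.
rewrite [delta in leRHS]splitr mulrDl; apply: lerD hbad.
have ex_F x : exists F : seq {set X k.+1}, x \in C -> [/\ size F = t,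
    pairwise (fun P P' : {set X k.+1} => [disjoint P & P']) F,
    all (fun P : {set X k.+1} => #|P| <= n)%N F &
    all (fun P : {set X k.+1} => dep (stab k) (enum P) x) F].
  case: (boolP (x \in C)) => [|_]; last by exists [::].
  rewrite inE => /andP[xbad xret].
  have [||F HF] := @disjoint_returns k s x kappa eta t xret (ltW eta0).
  - move=> j /andP[j0 js]; apply: contraNT xbad => nspr.
    rewrite /bad (big_rem j) /=; first by rewrite finset.in_setU finset.in_setC nspr.
    by rewrite mem_iota j0 add1n ltnS -sn.
  - by rewrite sn.
  by exists F => _; rewrite -sn.
have [F HF] := choice ex_F.
have [|Rs HR] := @random_hitting _ q C F n t ht.
  by move=> x /HF[].
set D := [set x in C | _] in HR.
(* A vertex of [C] is determined by a set inside [Rs] or else lies in [D] and is determined by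
   itself. *)
apply: (@le_trans _ _ #|Rs :|: D|%:R).
  apply: entropy_le_of_traces; apply: traces_dep => x xC.
  have [_ _ _ depF] := HF x xC.
  case: (boolP (has (fun P : {set _} => P \subset Rs) (F x))) => [/hasP[P PF PR]|nh].
    by exists P; [rewrite (fintype.subset_trans PR) ?finset.subsetUl|exact: (allP depF)].
  exists [set x]; first by rewrite finset.sub1set finset.in_setU [x \in D]inE xC nh orbT.
  apply/forall_inP => v _; apply/implyP => /allP; apply.
  by rewrite mem_enum inE.
have : (q.+1 * #|Rs :|: D| <= 2 * #|X k.+1|)%N.
  by apply: leq_trans HR; rewrite leq_mul2l leq_card_setU orbT.
rewrite -(ler_nat R) !natrM mulrC -ler_pdivlMr ?ltr0n // => /le_trans; apply.
by rewrite mulrAC ler_wpM2r.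
Qed.

(** * How often the concentration can be halved *)

Section Step.
Variables (a : letter r) (s : seq (letter r)) (eta kappa : R).
Hypothesis red : reduced (a :: s).

Let unsettled k : {set X k.+1} := ~: spread k.+1 (a :: s) eta :\: returning k s kappa.

(* Counts the ancestors at which the concentration of [a :: s] is halved. *)
Fixpoint escapes k : X k -> nat :=
  if k is k'.+1 then fun x => (escapes (par x) + (x \in unsettled k'))%N else fun=> 0%N.

(** The errors do not accumulate because [2 * kappa] is the fixed point of [z / 2 + kappa]. *)
Lemma law_prob_escapes k (x y : X k) : 0 < kappa ->
  law_prob (a :: s) x y <= (2^-1) ^+ escapes x + 2 * kappa.
Proof.
move=> kappa0; elim: k => [|k IH] in x y *.
  by rewrite expr0; apply: le_trans (law_prob_le1 _ _ _) _; lra.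
rewrite /=; case: (boolP (x \in unsettled k)) => [|_].
  rewrite inE => /andP[xret _]; rewrite addn1 exprS.
  apply: le_trans (law_prob_escape y red xret) _; have := IH (par x) (par y).
  by move: (law_prob _ _ _) (_ ^+ _) => P c hP; rewrite [2^-1 * c]mulrC; lra.
by rewrite addn0; apply: le_trans (law_prob_le_par _ _ _) (IH _ _).
Qed.

(** After [q] escapes the concentration is at most [eta] and remains so at all descendants, none of
    which is then unsettled. *)
Lemma escapes_bounded q k (x : X k) : 0 < kappa -> (2^-1) ^+ q + 2 * kappa <= eta ->
  (escapes x <= q)%N.
Proof.
move=> kappa0 hq; elim: k => [|k IH] in x * => //=.
case: (boolP (x \in unsettled k)) => [|_]; last by rewrite addn0.
rewrite addn1 !inE => /andP[_]; rewrite negb_forall => /existsP[y].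
rewrite -ltNge => lt_eta; rewrite ltnNge; apply/negP => qe.
have := lt_le_trans lt_eta
  (le_trans (law_prob_le_par _ _ _) (law_prob_escapes (par x) (par y) kappa0)).
apply/negP; rewrite -leNgt; apply: le_trans hq; rewrite lerD2r.
by apply: ler_wiXn2l; rewrite ?invr_ge0 // invf_le1 ?ltr0n // ler1n.
Qed.

Lemma sum_escapes k :
  (\sum_(x : X k.+1) escapes x =
   m k * \sum_(x : X k) escapes x + #|unsettled k|)%N.
Proof.
rewrite big_split /=; congr (_ + _)%N; last first.
  by rewrite -sum1_card [RHS]big_mkcond; apply: eq_bigr => x _; case: (x \in _).
rewrite (partition_big (@par k) xpredT) //= big_distrr /=; apply: eq_bigr => y _.
rewrite (eq_bigr (fun=> escapes y)) => [|x /eqP -> //].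
by rewrite sum_nat_const -(card_children y); congr (_ * _)%N; apply: eq_card => x; rewrite inE.
Qed.

(** The mean number of escapes on a level grows by exactly the density of [unsettled k]. It is
    bounded by [escapes_bounded], so it converges and its increments tend to 0. *)
Lemma unsettled_sparse (delta : R) : 0 < kappa -> 2 * kappa < eta -> 0 < delta ->
  exists k0, forall k, (k0 <= k)%N -> #|unsettled k|%:R <= delta * #|X k.+1|%:R.
Proof.
move=> kappa0 lt_eta delta0.
have [q hq] : exists q, (2^-1) ^+ q + 2 * kappa <= eta.
  pose d := eta - 2 * kappa; have d0 : 0 < d by rewrite subr_gt0.
  exists (Num.truncn d^-1).+1; rewrite -lerBrDr -/d exprVn invf_ple ?posrE //.
  apply: le_trans (ltW (truncnS_gt _)) _.
  by rewrite -natrX ler_nat ltnW // ltn_expl.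
pose u k : R := (\sum_(x : X k) escapes x)%:R / #|X k|%:R.
have X0 k : (0 : R) < #|X k|%:R by rewrite ltr0n level_gt0.
have uS k : u k.+1 = u k + #|unsettled k|%:R / #|X k.+1|%:R.
  rewrite /u sum_escapes natrD mulrDl card_level !natrM; congr (_ + _).
  rewrite -mulf_div divff ?mul1r // pnatr_eq0 -lt0n.
  by case/andP: (m_bounds k) => /ltnW.
have u_le k : u k <= q%:R.
  rewrite ler_pdivrMr // -natrM ler_nat mulnC -sum_nat_const.
  by apply: leq_sum => x _; apply: escapes_bounded.
have u_cvg : cvgn u.
  apply: nondecreasing_is_cvgn.
    by apply/nondecreasing_seqP => k; rewrite uS lerDl divr_ge0 // ltW.
  by exists q%:R => _ [k _ <-].
have d_cvg : ((fun k => u k.+1 - u k) @ \oo --> (0 : R))%classic.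
  rewrite -(subrr (limn u)); apply: cvgB => //.
  by rewrite (cvg_shiftS u).
have /cvgrPdist_le/(_ _ delta0)[k0 _ hk0] := d_cvg.
exists k0 => k /hk0 /=; rewrite sub0r normrN uS addrC addKr.
rewrite ger0_norm ?divr_ge0 //.
by rewrite ler_pdivrMr.
Qed.

End Step.

Lemma spreadsP n : spreads n.
Proof.
elim: n => [|n IH] t red; first by case: t red => // _ /andP[].
case: t red => [_ /andP[]//|a s red]; rewrite /= ltnS => sn eta eta0.
have IHs : spreads (size s).
  by move=> t redt /andP[t0 ts]; apply: IH => //; rewrite t0 (leq_trans ts).
have reds : reduced s by apply: path_sorted red.
(* The limiting error [2 * kappa] has to stay below [eta]. *)
pose kappa := eta / 4; have kappa0 : 0 < kappa by rewrite divr_gt0.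
have lt_eta : 2 * kappa < eta by rewrite /kappa; lra.
apply: (@negligible_sub _ (fun k => (~: spread k.+1 (a :: s) eta :\: returning k s kappa)
   :|: returning k s kappa)).
  by move=> k; apply/fintype.subsetP => x; rewrite !inE => ->; rewrite andbT orNb.
apply: negligibleU; last exact: returning_negligible IHs _ _ _.
move=> delta delta0.
have [k0 hk0] := unsettled_sparse red kappa0 lt_eta delta0.
by exists k0 => k /hk0; apply: le_trans (entropy_le_card _).
Qed.

(** A law sends [x] to [x] with probability 1, so no vertex is spread with bound [1/2]. *)
Lemma law_negligible w : reduced w -> w <> [::] ->
  (forall k p, p \in tuples k -> forall x, ev p w x = x) ->
  negligible (fun k => [set: X k.+1]).
Proof.
move=> red w0 law.
have w_size : (0 < size w <= size w)%N by case: (w) w0 => //= a s _; rewrite leqnn.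
have h2 : 0 < 2^-1 :> R by rewrite invr_gt0.
apply: negligible_sub (spreadsP red w_size h2) => k.
apply/fintype.subsetP => x _; rewrite !inE negb_forall; apply/existsP; exists x.
rewrite -ltNge /law_prob (_ : [set p in _ | _] = tuples k.+1).
  by rewrite divff ?lt0r_neq0 ?tuples_gt0 // invf_lt1 // ltr1n.
apply/setP => p; rewrite inE; case pA: (p \in _) => //=.
by rewrite law ?eqxx.
Qed.

(** The logarithms of the kernel orders add up. As level sizes at least double, the sum of their
    bounds is geometric and dominated by the last level. *)
Lemma ln_tower_negligible (delta : R) : negligible (fun k => [set: X k.+1]) ->
  0 < delta -> exists k0, forall k, (k0 <= k)%N -> ln #|A k|%:R <= delta * #|X k|%:R :> R.
Proof.
move=> neg delta0; pose d := delta / 4 / ln M%:R.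
have [|k0 hk0] := neg d; first by rewrite !divr_gt0 ?lnM_gt0.
have Xdouble k : 2 * #|X k|%:R <= #|X k.+1|%:R :> R.
  by rewrite card_level -natrM ler_nat leq_mul2r; case/andP: (m_bounds k) => ->; rewrite orbT.
have stab_le k : (k0 <= k)%N -> ln #|stab k|%:R <= delta / 4 * #|X k.+1|%:R :> R.
  move=> /hk0; rewrite /entropy card_tracesT ler_pdivrMr ?lnM_gt0 // => /le_trans; apply.
  by rewrite mulrAC /d divfK // lt0r_neq0 ?lnM_gt0.
have step k : ln #|A k.+1|%:R = ln #|stab k|%:R + ln #|A k|%:R :> R.
  by rewrite card_tower natrM lnM // posrE ltr0n ?cardG_gt0 // (cardG_gt0 (stab_group k)).
have rec j : ln #|A (j + k0)%N|%:R <= ln #|A k0|%:R + delta / 2 * #|X (j + k0)%N|%:R :> R.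
  elim: j => [|j IH]; first by rewrite lerDl mulr_ge0 // divr_ge0 // ltW.
  rewrite addSn step; have := stab_le (j + k0)%N (leq_addl _ _).
  move: IH (Xdouble (j + k0)%N).
  move: (ln _) (ln _) (ln _) => a b c IH dbl st.
  have : delta / 4 * (2 * #|X (j + k0)%N|%:R) <= delta / 4 * #|X (j + k0).+1|%:R.
    by rewrite ler_wpM2l // divr_ge0 // ltW.
  lra.
(* Level sizes are unbounded, which absorbs the constant [ln #|A k0|%:R]. *)
have Xk k : (k%:R : R) <= #|X k|%:R.
  rewrite ler_nat; elim: k => // k IH; rewrite -(ler_nat R).
  apply: le_trans (Xdouble k); rewrite -natrM ler_nat mul2n -addnn.
  by rewrite -addn1 leq_add // level_gt0.
exists (k0 + (Num.truncn (ln #|A k0|%:R / (delta / 2))).+1)%N => k hk.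
have := rec (k - k0)%N; rewrite subnK; last by apply: leq_trans hk; rewrite leq_addr.
move=> /le_trans; apply.
suff : ln #|A k0|%:R <= delta / 2 * #|X k|%:R by lra.
rewrite mulrC -ler_pdivrMr ?divr_gt0 //; apply: le_trans (Xk k).
apply: le_trans (ltW (truncnS_gt _)) _; rewrite ler_nat.
by apply: leq_trans hk; rewrite leq_addl.
Qed.

End LevelTower.

(** * Level permutations of a bounded tree *)

Section TreeLevels.
Variable T : rooted_tree.
Implicit Types u v x y : T.

Lemma level_root : level (Defs.root T) = 0%N.
Proof.
rewrite /level /dist; case: ex_minnP => n _ /(_ 0%N).
rewrite leqn0 => H; apply/eqP/H; apply/asboolP.
by exists [::].
Qed.

Lemma level_path v : joined_by (Defs.root T) v (level v).
Proof. by rewrite /level /dist; case: ex_minnP => n /asboolP. Qed.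

Lemma level_le v n : joined_by (Defs.root T) v n -> (level v <= n)%N.
Proof.
by rewrite /level /dist; case: ex_minnP => m _ H jn; apply/H/asboolP.
Qed.

Lemma level0 v : level v = 0%N -> v = Defs.root T.
Proof.
move=> v0; have [p [_ lp]] := level_path v.
by rewrite v0 -lp; case: p {lp}.
Qed.

Lemma adj_level u v : adj u v -> (level v <= (level u).+1)%N.
Proof.
move=> uv; have [p [rp lp sp]] := level_path u; apply: level_le.
exists (rcons p v); split; first by rewrite rcons_path rp lp.
  by rewrite last_rcons.
by rewrite size_rcons sp.
Qed.

Lemma exists_parent v k : level v = k.+1 -> exists2 u, adj v u & level u = k.
Proof.
move=> vk; have [p [rp lp sp]] := level_path v.
case: (lastP p) rp lp sp => [|q w]; first by rewrite vk.
rewrite rcons_path last_rcons size_rcons vk => /andP[rq aq] ew [sq].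
rewrite {}ew in aq; exists (last (Defs.root T) q); first by rewrite adj_sym.
apply/eqP; rewrite eqn_leq; apply/andP; split; first by apply: level_le; exists q.
by rewrite -ltnS -vk; apply: adj_level.
Qed.

Lemma path_to_root v : exists p, [/\ path (@adj T) v p, last v p = Defs.root T &
  all (fun u => level u < level v)%N p].
Proof.
have [n le_n] := ubnP (level v); elim: n => // n IH in v le_n *.
case vk: (level v) => [|k]; first by exists [::]; rewrite /= (level0 vk).
have [u vu uk] := exists_parent vk.
have [|p [up lp ap]] := IH u; first by rewrite uk -ltnS -vk.
exists (u :: p); split; rewrite /= ?vu ?uk ?ltnSn //=.
by apply: sub_all ap => w; rewrite uk => /ltnW.
Qed.

(** Paths from [u] and [u'] to the root through lower levels avoid [v]. Joined, shortened to a
    simple path and closed at [v], they would form a cycle. Equal levels are allowed so that edges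
    inside a level are excluded too. *)
Lemma unique_lower_neighbour v u u' : adj v u -> adj v u' ->
  (level u <= level v)%N -> (level u' <= level v)%N -> u = u'.
Proof.
move=> vu vu' lu lu'; apply: contrapT => uu'.
have avoid w : adj v w -> (level w <= level v)%N ->
    exists p, [/\ path (@adj T) w p, last w p = Defs.root T & v \notin w :: p].
  move=> vw lw; have [p [wp lp ap]] := path_to_root w; exists p; split=> //.
  rewrite inE negb_or; apply/andP; split.
    by apply: contraTneq vw => ->; rewrite adj_irr.
  by apply/negP => /(allP ap); rewrite ltnNge lw.
have [p [up lp vp]] := avoid u vu lu; have [p' [up' lp' vp']] := avoid u' vu' lu'.
pose q := p ++ rev (belast u' p').
have uq : path (@adj T) u q.
  rewrite cat_path up lp -lp' rev_path.
  by rewrite (eq_path (e' := @adj T)) // => x y; rewrite adj_sym.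
have lq : last u q = u'.
  rewrite last_cat lp -lp'; case: (p') => //= z p2.
  by rewrite rev_cons last_rcons.
have vq : v \notin u :: q.
  move: vp vp'; rewrite !inE mem_cat mem_rev !negb_or => /andP[-> ->] /=.
  rewrite -negb_or -in_cons; apply: contra.
  exact: mem_belast.
move: lq vq; case/shortenP: uq => q' uq' un' sub lq vq.
apply: (@adj_acyclic T (v :: u :: q')).
  by case: q' lq {uq' un' sub} => //= e; case: uu'.
rewrite /ucycle /= vu rcons_path uq' lq adj_sym vu' /=.
apply/andP; split=> //; apply: contra vq; rewrite !inE => /orP[->//|/sub ->].
by rewrite orbT.
Qed.

(** The root has no such neighbour and is its own parent by default. *)
Definition parent v : T :=
  xget (Defs.root T) [set u | adj v u /\ level v = (level u).+1]%classic.

Lemma parentP v k : level v = k.+1 -> adj v (parent v) /\ level (parent v) = k.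
Proof.
move=> vk; have [u vu uk] := exists_parent vk.
have [a e] : adj v (parent v) /\ level v = (level (parent v)).+1.
  by apply: (@xgetPex _ _ [set u | adj v u /\ level v = (level u).+1]%classic);
    exists u; rewrite /= uk.
by split=> //; move: e; rewrite vk => -[->].
Qed.

Lemma parent_eq u v : adj v u -> level v = (level u).+1 -> parent v = u.
Proof.
move=> vu lv; have [vp lp] := parentP lv.
by apply: (@unique_lower_neighbour v) => //; rewrite lv ?lp leqnSn.
Qed.

Lemma adj_parent x y : adj x y ->
  (level x = (level y).+1 /\ parent x = y) \/ (level y = (level x).+1 /\ parent y = x).
Proof.
have main u v : adj v u -> (level u <= level v)%N -> level v = (level u).+1 /\ parent v = u.
  move=> vu uv; case lv: (level v) => [|k].
    move: uv; rewrite lv leqn0 => /eqP lu.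
    by move: vu; rewrite (level0 lv) (level0 lu) adj_irr.
  have [vp lp] := parentP lv.
  have e : parent v = u by apply: (@unique_lower_neighbour v) => //; rewrite lp lv leqnSn.
  by split=> //; rewrite -e lp.
move=> xy; case: (leqP (level x) (level y)) => [xy_le|/ltnW yx_le].
  by right; apply: main => //; rewrite adj_sym.
by left; apply: main.
Qed.

Lemma childrenP u v : children u v <-> parent v = u /\ level v = (level u).+1.
Proof.
split=> [[uv lv]|[<- lv]]; last by have [vp lp] := parentP lv; split; rewrite // adj_sym.
by split=> //; apply: parent_eq; rewrite // adj_sym.
Qed.

Lemma parent_aut (g : Aut T) v : (0 < level v)%N -> parent (g v) = g (parent v).
Proof.
case lv: (level v) => [//|k] _; have [vp lp] := parentP lv.
by apply: parent_eq; rewrite ?aut_adj // !level_aut lp.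
Qed.

End TreeLevels.

(** * Permutations induced on the levels *)

Section BoundedTree.
Variables (T : rooted_tree) (M : nat) (m : nat -> nat).
Hypothesis m_bounds : forall k, (2 <= m k <= M)%N.
Hypothesis card_children : forall v : T, (children v #= `I_(m (level v)))%card.
Implicit Types (u v : T) (g : Aut T).

Definition child_seq v : seq T := fset_set (children v).

Lemma finite_children v : finite_set (children v).
Proof. by exists (m (level v)). Qed.

Lemma mem_child_seq u v : (v \in child_seq u) = `[< children u v >].
Proof. by rewrite /child_seq in_fset_set ?asboolE //; exact: finite_children. Qed.

Lemma size_child_seq v : size (child_seq v) = m (level v).
Proof. exact: card_fset_set (card_children v). Qed.

Lemma child_seq_uniq v : uniq (child_seq v).
Proof. exact: fset_uniq. Qed.

Definition level_set k : set T := [set v | level v = k]%classic.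

Lemma finite_level_set k : finite_set (level_set k).
Proof.
elim: k => [|k IH].
  apply: (@sub_finite_set _ _ [set Defs.root T]%classic) => //.
  by move=> v /level0 ->.
apply: sub_finite_set (bigcup_finite IH (fun v _ => finite_children v)) => v vk.
have [vp lp] := parentP vk; exists (parent v) => //.
by apply/childrenP; rewrite lp.
Qed.

Definition level_type k : finType := fset_set (level_set k).

Lemma level_typeP k (x : level_type k) : level (val x) = k.
Proof.
by have := valP x; rewrite in_fset_set ?inE //; exact: finite_level_set.
Qed.

Lemma mem_level v k : level v = k -> v \in fset_set (level_set k).
Proof. by move=> vk; rewrite in_fset_set ?inE //; exact: finite_level_set. Qed.

Definition vertex_at v k (vk : level v = k) : level_type k := [` mem_level vk]%fset.

Lemma parent_at_level k (x : level_type k.+1) : level (parent (val x)) = k.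
Proof. by have [] := parentP (level_typeP x). Qed.

Definition level_parent k (x : level_type k.+1) : level_type k :=
  vertex_at (parent_at_level x).

Lemma card_level_children k (y : level_type k) :
  #|[set x | level_parent x == y]| = m k.
Proof.
have <- : size (child_seq (val y)) = m k by rewrite size_child_seq level_typeP.
rewrite cardE -(size_map val); apply/perm_size/uniq_perm.
- by rewrite (map_inj_uniq val_inj) enum_uniq.
- exact: child_seq_uniq.
move=> v; rewrite mem_child_seq; apply/mapP/asboolP => [[x]|/childrenP[pv lv]].
  rewrite mem_enum inE => /eqP <- ->; apply/childrenP.
  by rewrite /= level_typeP parent_at_level.
rewrite level_typeP in lv; exists (vertex_at lv) => //.
by rewrite mem_enum inE -val_eqE /= pv.
Qed.

Lemma card_level0 : (0 < #|level_type 0|)%N.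
Proof. by apply/card_gt0P; exists (vertex_at (level_root T)). Qed.

Lemma aut_at_level g k (x : level_type k) : level (g (val x)) = k.
Proof. by rewrite level_aut level_typeP. Qed.

Definition level_fun g k (x : level_type k) : level_type k :=
  vertex_at (aut_at_level g x).

Lemma level_fun_inj g k : injective (@level_fun g k).
Proof.
move=> x y /(congr1 val) /= e; apply: val_inj.
by case: (aut_bij g) => f gK _; rewrite -(gK (val x)) e gK.
Qed.

Definition level_perm k g : {perm level_type k} := perm (@level_fun_inj g k).

Lemma level_permE k g x : val (level_perm k g x) = g (val x).
Proof. by rewrite permE. Qed.

(** The order is reversed because [Aut T] multiplies by composition. *)
Lemma level_permM k g h : level_perm k (g * h)%g = (level_perm k h * level_perm k g)%g.
Proof. by apply/permP => x; apply: val_inj; rewrite permM !level_permE. Qed.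

Lemma level_perm1 k : level_perm k 1%g = 1%g.
Proof. by apply/permP => x; apply: val_inj; rewrite perm1 level_permE. Qed.

Lemma level_permV k g : level_perm k g^-1%g = (level_perm k g)^-1%g.
Proof.
apply: (@mulgI _ (level_perm k g)); rewrite mulgV -level_permM mulVg.
exact: level_perm1.
Qed.

Lemma level_perm_parent k g x :
  level_parent (level_perm k.+1 g x) = level_perm k g (level_parent x).
Proof.
apply: val_inj; rewrite level_permE /= permE /=.
by rewrite parent_aut // level_typeP.
Qed.

(** Left cosets of [St k] thus correspond to induced permutations, which is how indices are
    counted. *)
Lemma level_perm_St k g h : level_perm k g = level_perm k h <-> St k (g^-1 * h)%g.
Proof.
have actM (a b : Aut T) v : (a * b)%g v = a (b v) by [].
split=> [e v vk|st]; last first.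
  apply/permP => x; apply: val_inj; rewrite !level_permE.
  by rewrite -[in RHS](mulKVg g h) actM (st _ (level_typeP x)).
rewrite actM; have := congr1 (fun p : {perm _} => val (p (vertex_at vk))) e.
rewrite !level_permE /= => <-.
by have /(congr1 (fun f : Aut T => f v)) := mulVg g.
Qed.

Definition transpose01 (b : bool) (i : nat) : nat :=
  if b then (if i is i'.+1 then (if i' is 0 then 0 else i) else 1) else i.

Lemma transpose01K b : involutive (transpose01 b).
Proof. by case: b => -[|[|i]]. Qed.

Lemma transpose01_lt b i k : (i < m k)%N -> (transpose01 b i < m k)%N.
Proof. by case/andP: (m_bounds k); case: b i => [] [|[|i]] //=; lia. Qed.

(** * Automorphisms exchanging the first two children *)

Section Swap.
Variables (n : nat) (S : {ffun level_type n -> bool}).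

Definition swaps u : bool :=
  (level u == n) && [exists x, (val x == u) && S x].

(** [u] stands for the image of the parent of [v]: the rank of [v] among its siblings is kept, up to
    exchanging ranks 0 and 1 if [u] is selected. *)
Definition child_swap v u : T :=
  nth (Defs.root T) (child_seq u)
    (transpose01 (swaps u) (index v (child_seq (parent v)))).

Fixpoint swap_rec k v : T :=
  if k is k'.+1 then child_swap v (swap_rec k' (parent v)) else v.

(* The automorphism that exchanges, below each vertex of level [n] selected by
   [S], the first two children together with their subtrees. *)
Definition swap v : T := swap_rec (level v) v.

Lemma swap_root v : level v = 0 -> swap v = v.
Proof. by rewrite /swap => ->. Qed.

Lemma swapE v k : level v = k.+1 -> swap v = child_swap v (swap (parent v)).
Proof. by move=> vk; rewrite /swap (proj2 (parentP vk)) vk. Qed.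

Lemma index_child_seq v k : level v = k.+1 ->
  (index v (child_seq (parent v)) < m k)%N.
Proof.
move=> vk; have [vp lp] := parentP vk.
rewrite -lp -size_child_seq index_mem mem_child_seq.
by apply/asboolP/childrenP; rewrite lp.
Qed.

Lemma swap_child v k : level v = k.+1 -> level (swap (parent v)) = k ->
  children (swap (parent v)) (swap v).
Proof.
move=> vk lk; apply/asboolP; rewrite -mem_child_seq (swapE vk); apply: mem_nth.
by rewrite size_child_seq lk transpose01_lt // index_child_seq.
Qed.

Lemma level_swap v : level (swap v) = level v.
Proof.
have [k le_k] := ubnP (level v); elim: k => // k IH in v le_k *.
case vk: (level v) => [|j]; first by rewrite swap_root.
have [vp lp] := parentP vk.
have lk : level (swap (parent v)) = j by rewrite IH lp // -ltnS -vk.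
by have /childrenP[_ ->] := swap_child vk lk; rewrite lk.
Qed.

Lemma parent_swap v k : level v = k.+1 -> parent (swap v) = swap (parent v).
Proof.
move=> vk; have [vp lp] := parentP vk.
have lk : level (swap (parent v)) = k by rewrite level_swap.
by have /childrenP[] := swap_child vk lk.
Qed.

Lemma swap_low v : (level v <= n)%N -> swap v = v.
Proof.
have [k le_k] := ubnP (level v); elim: k => // k IH in v le_k *.
case vk: (level v) => [|j] jn; first by rewrite swap_root.
have [vp lp] := parentP vk.
have IHp : swap (parent v) = parent v.
  by apply: IH; rewrite lp; [rewrite -ltnS -vk | apply: ltnW].
rewrite (swapE vk) IHp /child_swap /swaps lp (ltn_eqF jn) /= nth_index //.
by rewrite mem_child_seq; apply/asboolP/childrenP; rewrite lp.
Qed.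

Lemma swapK : involutive swap.
Proof.
move=> v; have [k le_k] := ubnP (level v); elim: k => // k IH in v le_k *.
case vk: (level v) => [|j]; first by rewrite !swap_root.
have [vp lp] := parentP vk.
have svk : level (swap v) = j.+1 by rewrite level_swap.
have IHp : swap (swap (parent v)) = parent v by rewrite IH // lp -ltnS -vk.
(* Vertices of level [n] are fixed by [swap] and no others are selected, so the same transposition
   is applied twice. *)
have sw : swaps (parent v) = swaps (swap (parent v)).
  case: (ltngtP (level (parent v)) n) => h; last by rewrite swap_low // h.
    by rewrite /swaps level_swap (ltn_eqF h).
  by rewrite /swaps level_swap (gtn_eqF h).
rewrite (swapE svk) (parent_swap vk) IHp /child_swap (parent_swap vk).
rewrite (swapE vk) index_uniq ?child_seq_uniq //; last first.
  by rewrite size_child_seq level_swap lp transpose01_lt // index_child_seq.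
rewrite -sw transpose01K nth_index //.
by rewrite mem_child_seq; apply/asboolP/childrenP; rewrite lp.
Qed.

Lemma swap_adj_imp u v : adj u v -> adj (swap u) (swap v).
Proof.
have main x y : level x = (level y).+1 -> parent x = y -> adj (swap x) (swap y).
  move=> lx <-; rewrite -(parent_swap lx).
  have lsx : level (swap x) = (level y).+1 by rewrite level_swap.
  by have [] := parentP lsx.
by case/adj_parent => -[l p]; [|rewrite adj_sym]; apply: main.
Qed.

Lemma swap_adj u v : adj (swap u) (swap v) = adj u v.
Proof.
apply/idP/idP; last exact: swap_adj_imp.
by move/swap_adj_imp; rewrite !swapK.
Qed.

Definition swap_aut : Aut T :=
  MkAut (inv_bij swapK) swap_adj (swap_root (level_root T)).

End Swap.

(** The first child of [x] is moved exactly when [S x] holds. This gives one automorphism for each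
    subset of level [n], all distinct on level [n.+1]. *)
Lemma level_perm_swap_inj n : injective (fun S => level_perm n.+1 (@swap_aut n S)).
Proof.
move=> S S' eSS'; apply/ffunP => x; have lx := level_typeP x.
pose c := nth (Defs.root T) (child_seq (val x)) 0.
have m2 : (1 < m n)%N by case/andP: (m_bounds n).
have /childrenP[pc lc] : children (val x) c.
  apply/asboolP; rewrite -mem_child_seq mem_nth // size_child_seq lx.
  exact: ltnW.
rewrite lx in lc.
have swc S0 : swap S0 c = nth (Defs.root T) (child_seq (val x)) (S0 x).
  rewrite (swapE _ lc) pc swap_low ?lx // /child_swap pc index_uniq ?child_seq_uniq //.
    congr nth; rewrite /swaps lx eqxx /=.
    have -> : [exists y, (val y == val x) && S0 y] = S0 x.
      apply/existsP/idP => [[y /andP[/eqP/val_inj ->]] //|Sx].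
      by exists x; rewrite eqxx.
    by case: (S0 x).
  by rewrite size_child_seq lx ltnW.
have := congr1 (fun p : {perm _} => val (p (vertex_at lc))) eSS'.
rewrite !level_permE /= !swc => /eqP.
rewrite nth_uniq ?child_seq_uniq ?size_child_seq ?lx //.
- by case: (S x) (S' x) => [] [].
- by case: (S x) => //; apply: ltnW.
- by case: (S' x) => //; apply: ltnW.
Qed.

(** * Indices of level stabilizers *)

Section Cosets.
Variables (k : nat) (H : set (Aut T)).
Hypothesis H_closed : forall g h, H g -> H h -> H (g^-1 * h)%g.

Let coset g : set (Aut T) := [set (g * x)%g | x in H `&` St k]%classic.

Let coset_eqP g h : H g -> H h -> level_perm k g = level_perm k h -> coset g = coset h.
Proof.
have sub a b : H a -> H b -> level_perm k a = level_perm k b -> (coset a `<=` coset b)%classic.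
  move=> Ha Hb eab _ [x [Hx Sx] <-]; exists (b^-1 * (a * x))%g; last by rewrite mulKVg.
  have H1 : H 1%g by rewrite -(mulVg a); apply: H_closed.
  have HV c : H c -> H c^-1%g by move=> Hc; rewrite -(mulg1 c^-1%g); apply: H_closed.
  split; first by apply: H_closed => //; rewrite -(invgK a); apply: H_closed => //; apply: HV.
  by rewrite mulgA; apply: StM => //; apply/level_perm_St.
by move=> Hg Hh e; apply/seteqP; split; apply: sub.
Qed.

Let cosets_sub (A : {set {perm level_type k}}) : (forall g, H g -> level_perm k g \in A) ->
  exists f : {perm level_type k} -> set (Aut T),
    ([set coset g | g in H] `<=` [set f p | p in [set` A]])%classic.
Proof.
move=> HA; exists (fun p => coset (xget 1%g [set g | H g /\ level_perm k g = p]%classic)).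
move=> _ [g Hg <-]; exists (level_perm k g); first exact: HA.
have [Hx ex] := @xgetI _ 1%g
  [set h | H h /\ level_perm k h = level_perm k g]%classic g (conj Hg erefl).
exact: coset_eqP.
Qed.

(** Guards against the default value 0 of [subgroup_index] on infinitely many cosets. *)
Lemma finite_cosets : finite_set [set coset g | g in H]%classic.
Proof.
have [|f sub] := @cosets_sub [set: {perm level_type k}].
  by move=> g _; rewrite inE.
by apply: sub_finite_set sub _; apply: finite_image; apply: finite_finset.
Qed.

Lemma subgroup_index_le (A : {set {perm level_type k}}) :
  (forall g, H g -> level_perm k g \in A) ->
  (subgroup_index H (H `&` St k)%classic <= #|A|)%N.
Proof.
move=> HA; have [f sub] := cosets_sub HA.
rewrite /subgroup_index cardE -(size_map f).
apply: uniq_leq_size; first exact: fset_uniq.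
move=> C; rewrite in_fset_set ?inE; last exact: finite_cosets.
move=> /sub[p pA <-]; apply: map_f; rewrite mem_enum; exact: pA.
Qed.

Lemma subgroup_index_ge (I : finType) (c : I -> Aut T) :
  (forall i, H (c i)) -> injective (fun i => level_perm k (c i)) ->
  (#|I| <= subgroup_index H (H `&` St k)%classic)%N.
Proof.
move=> Hc c_inj; rewrite /subgroup_index cardE -(size_map (fun i => coset (c i))).
apply: uniq_leq_size.
  rewrite map_inj_uniq ?enum_uniq // => i j eij; apply: c_inj.
  have H1 : H 1%g by rewrite -(mulVg (c i)); apply: H_closed.
  have : coset (c i) (c i) by exists 1%g; rewrite ?mulg1 //; split=> //; apply: St1.
  rewrite eij => -[x [_ Sx] <-]; apply/esym/level_perm_St.
  by rewrite mulKg.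
move=> C /mapP[i _ ->]; rewrite in_fset_set ?inE; last exact: finite_cosets.
by exists (c i).
Qed.

End Cosets.

End BoundedTree.

(** * The image of a homomorphism on the levels *)

Section Image.
Variables (T : rooted_tree) (m : nat -> nat).
Hypothesis card_children : forall v : T, (children v #= `I_(m (level v)))%card.
Variables (G : groupType) (rho : {multiplicative G -> Aut T}).

Lemma multiplicative1 : rho 1%g = 1%g.
Proof. by apply: (@mulgI _ (rho 1%g)); rewrite -gmulfM !mulg1. Qed.

Lemma multiplicativeV g : rho g^-1%g = (rho g)^-1%g.
Proof. by apply: (@mulgI _ (rho g)); rewrite -gmulfM !mulgV multiplicative1. Qed.

Definition image_perms k : {set {perm level_type T k}} :=
  [set p | `[< exists g, level_perm card_children k (rho g) = p >]].

Lemma image_permsP k p :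
  reflect (exists g, level_perm card_children k (rho g) = p) (p \in image_perms k).
Proof. by rewrite inE; apply: asboolP. Qed.

Lemma image_perms_group_set k : group_set (image_perms k).
Proof.
apply/group_setP; split; first by apply/image_permsP; exists 1%g; rewrite multiplicative1 level_perm1.
move=> p q /image_permsP[g <-] /image_permsP[h <-]; apply/image_permsP.
by exists (h * g)%g; rewrite gmulfM level_permM.
Qed.
Canonical image_perms_group k := Group (image_perms_group_set k).

Lemma image_descend k a : a \in image_perms k.+1 -> exists2 b, b \in image_perms k &
  forall x, level_parent card_children (a x) = b (level_parent card_children x).
Proof.
case/image_permsP=> g <-; exists (level_perm card_children k (rho g)).
  by apply/image_permsP; exists g.
exact: level_perm_parent.
Qed.

Lemma image_lift k b : b \in image_perms k -> exists2 a, a \in image_perms k.+1 &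
  forall x, level_parent card_children (a x) = b (level_parent card_children x).
Proof.
case/image_permsP=> g <-; exists (level_perm card_children k.+1 (rho g)).
  by apply/image_permsP; exists g.
exact: level_perm_parent.
Qed.

(** A tuple of induced permutations lifts to a tuple of [G], where the law holds. *)
Lemma image_law r (w : free_group r) :
  (forall g : 'I_r -> G, law_eval g w = 1%g) ->
  forall k p, p \in tuples (image_perms k) -> forall x, ev p w x = x.
Proof.
move=> law k p /tuplesP pA x.
have lift_p i : exists h, level_perm card_children k (rho h) = p i by apply/image_permsP.
have [g gp] := choice lift_p.
suff -> : ev p w x = level_perm card_children k (rho (law_eval g w)) x.
  by rewrite law multiplicative1 level_perm1 perm1.
rewrite /law_eval; elim: (word w) => [|a s IH] /=.
  by rewrite multiplicative1 level_perm1 perm1.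
rewrite gmulfM level_permM permM -IH /lperm /letter_eval -gp.
by case: a.2; rewrite ?multiplicativeV ?level_permV.
Qed.

End Image.

(** * Comparison of the two indices *)

Local Open Scope ring_scope.

Theorem corollary2 (R : realType) (G : topologicalGroupType) (T : rooted_tree)
    (rho : {multiplicative G -> Aut T}) :
  satisfies_law G -> bounded_tree T -> continuous rho ->
  strong_zero_hausdorff_dimension R (range rho).
Proof.
move=> [r [_ [w [w1 law]]]] [_ [M [m [_ m_bounds card_children]]]] _.
have w_neq : word w <> [::] by move=> e; apply: w1; apply: val_inj.
set A := image_perms_group card_children rho.
have small := ln_tower_negligible (R := R) m_bounds (card_level_children card_children)
  (card_level0 card_children) (@image_descend _ _ card_children _ rho)
  (@image_lift _ _ card_children _ rho)
  (law_negligible m_bounds (card_level_children card_children)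
    (card_level0 card_children) (@image_descend _ _ card_children _ rho)
    (@image_lift _ _ card_children _ rho) (word_reduced w) w_neq
    (image_law law)).
have H_closed g h : range rho g -> range rho h -> range rho (g^-1 * h)%g.
  by move=> [a _ <-] [b _ <-]; exists (a^-1 * b)%g; rewrite // gmulfM multiplicativeV.
have M0 : (0 < M)%N by case/andP: (m_bounds 0%N) => /ltnW/leq_trans; apply.
have ln2 : 0 < ln 2 :> R by rewrite ln_gt0 // ltr1n.
rewrite /strong_zero_hausdorff_dimension; apply/cvgrPdist_le => e e0.
(* [M] pays for the passage from level [k] to level [k.+1], and [ln 2] comes from the lower bound
   for the denominator. *)
have [|k0 hk0] := small (e * ln 2 / M%:R); first by rewrite divr_gt0 ?mulr_gt0 ?ltr0n.
exists k0.+1 => // -[//|k] /= hk; rewrite sub0r normrN.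
have num_le : ln (subgroup_index (range rho) (range rho `&` St k.+1)%classic)%:R
    <= e * ln 2 * #|level_type T k|%:R :> R.
  apply: (@le_trans _ _ (ln #|A k.+1|%:R)).
    have le_idx : (subgroup_index (range rho) (range rho `&` St k.+1)%classic <= #|A k.+1|)%N.
      apply: (subgroup_index_le H_closed (card_children := card_children)) => g [a _ <-].
      by apply/image_permsP; exists a.
    have [->|i0] := posnP (subgroup_index (range rho) (range rho `&` St k.+1)%classic).
      by rewrite ln0 // ln_ge0 // ler1n cardG_gt0.
    by rewrite ler_ln ?posrE ?ltr0n ?cardG_gt0 // ler_nat.
  apply: le_trans (hk0 k.+1 (leqW hk)) _.
  rewrite (card_level (card_level_children card_children)) natrM.
  have -> : e * ln 2 / M%:R * ((m k)%:R * #|level_type T k|%:R) =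
      e * ln 2 * #|level_type T k|%:R * ((m k)%:R / M%:R) :> R by ring.
  rewrite ler_piMr ?mulr_ge0 ?(ltW e0) ?(ltW ln2) //.
  rewrite ler_pdivrMr ?ltr0n // mul1r ler_nat.
  by case/andP: (m_bounds k).
(* The swaps at level [k] lie in distinct cosets of [St k.+1]. *)
have den_ge : ln 2 * #|level_type T k|%:R <=
    ln (subgroup_index [set: Aut T]%classic (St k.+1))%:R :> R.
  rewrite mulr_natr -lnXn ?ltr0n // -natrX.
  have idx : (2 ^ #|level_type T k| <=
      subgroup_index [set: Aut T]%classic (St k.+1))%N.
    rewrite -(setTI (St k.+1)) -card_bool -card_ffun.
    apply: (subgroup_index_ge _ _ (@level_perm_swap_inj T M m m_bounds card_children k)) => //.
  by rewrite ler_ln ?posrE ?ltr0n ?expn_gt0 // ?ler_nat // (leq_trans _ idx) ?expn_gt0.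
have N0 : 0 < ln 2 * #|level_type T k|%:R :> R.
  rewrite mulr_gt0 // ltr0n.
  exact: (level_gt0 m_bounds (card_level_children card_children) (card_level0 card_children)).
have num_ge0 : 0 <= ln (subgroup_index (range rho) (range rho `&` St k.+1)%classic)%:R :> R.
  by case: (subgroup_index _ _) => [|i]; [rewrite ln0 | rewrite ln_ge0 // ler1n].
have den0 := lt_le_trans N0 den_ge.
rewrite ger0_norm ?divr_ge0 ?(ltW den0) // ler_pdivrMr //.
apply: le_trans num_le _; rewrite -mulrA.
by rewrite ler_wpM2l // ltW.
Qed.
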